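(* (Abstract Borg's Theorem.) Let $(\lambda_k)_{k\ge1}$, $(\mu_k)_{k\ge1}$ be nonzero real numbers satisfying $$|\lambda_1|>|\mu_1|>|\lambda_2|>|\mu_2|>\dots>|\lambda_n|>|\mu_n|>\dots>0,$$ and $\lambda_k^2\to0$ as $k\to\infty$. Then there exists a triple $(W,W_1,p)$ on a separable Hilbert space $\mathcal{H}$, unique up to unitary equivalence, such that (1) $W=W^*\ge0$, $\ker W=\{0\}$, and $W$ is a compact operator whose eigenvalues are exactly the numbers $\lambda_k^2$, $k\ge1$, each simple; (2) $p\in\mathcal{H}$ and $W_1=W-pp^*$ is a compact operator whose nonzero eigenvalues are exactly the numbers $\mu_k^2$, $k\ge1$. Moreover, $\|W^{-1/2}p\|=1$ if and only if $$\sum_{j=1}^\infty\Big(1-\frac{\mu_j^2}{\lambda_j^2}\Big)=\infty;$$ and if this condition holds, then $\|W^{-1}p\|=\infty$ (i.e. $p\notin\operatorname{Ran}W$) if and only if $$\sum_{j=1}^\infty\Big(\frac{\mu_j^2}{\lambda_{j+1}^2}-1\Big)=\infty.$$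
   Context: A triple $(R,R_1,p)$ on $\mathcal{H}$ consists of two operators $R,R_1$ on $\mathcal{H}$ and a vector $p\in\mathcal{H}$. Triples $(R,R_1,p)$ on $\mathcal{H}$ and $(\tilde R,\tilde R_1,\tilde p)$ on $\tilde{\mathcal{H}}$ are unitarily equivalent if there is a unitary $U:\mathcal{H}\to\tilde{\mathcal{H}}$ with $\tilde R=URU^*$, $\tilde R_1=UR_1U^*$, $\tilde p=Up$. For $a\in\mathcal{H}$, $a^*$ denotes the functional $x\mapsto(x,a)$, so $pp^*x=(x,p)p$. If $(u_k)$ is an orthonormal eigenbasis of $W$ with $Wu_k=\lambda_k^2u_k$, then $\|W^{-s}p\|$ (for $s=1/2,1$) denotes $\big(\sum_k|(p,u_k)|^2\lambda_k^{-4s}\big)^{1/2}\in[0,\infty]$, which is finite exactly when $p\in\operatorname{Ran}W^{s}$. *)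

(* Defs.v *)
(* Scalars: the complex numbers R[i]
   over an arbitrary R : realType (mathcomp-real-closed's complex.v).
   There is no Hilbert-space library, so the needed notions are defined
   here directly, as in the paper. *)
From mathcomp Require Import all_boot all_order all_algebra.
From mathcomp Require Import all_classical all_reals ereal topology normedtype sequences.
From mathcomp Require Import complex.

Set Implicit Arguments.
Unset Strict Implicit.
Unset Printing Implicit Defensive.

Import Order.TTheory GRing.Theory Num.Theory.
Local Open Scope ring_scope.

Section HilbertDefs.
Variable R : realType.

(* |z|^2 for a complex number z, as a real number *)
Definition cnorm2 (z : R[i]) : R := complex.Re z ^+ 2 + complex.Im z ^+ 2.

Section OneSpace.
Variables (H : lmodType R[i]) (ip : H -> H -> R[i]).
(* ip x y = (x, y): linear in the first, conjugate-linear in the second slot *)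

Definition inner_product_axioms : Prop :=
  [/\ forall (a : R[i]) (x y z : H), ip (a *: x + y) z = a * ip x z + ip y z,
      forall x y : H, ip y x = ((ip x y)^*)%C,
      forall x : H, 0 <= ip x x
    & forall x : H, ip x x = 0 -> x = 0].

Definition hnorm (x : H) : R := Num.sqrt (complex.Re (ip x x)).

Definition hcvg (v : nat -> H) (l : H) : Prop :=
  forall e : R, 0 < e -> exists N : nat, forall n : nat, (N <= n)%N ->
    hnorm (v n - l) < e.

Definition hcomplete : Prop :=
  forall v : nat -> H,
    (forall e : R, 0 < e -> exists N : nat, forall m n : nat,
        (N <= m)%N -> (N <= n)%N -> hnorm (v m - v n) < e) ->
    exists l : H, hcvg v l.

Definition hseparable : Prop :=
  exists d : nat -> H, forall (x : H) (e : R), 0 < e ->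
    exists n : nat, hnorm (x - d n) < e.

(* (H, ip) is a separable (complex) Hilbert space *)
Definition separable_hilbert : Prop :=
  [/\ inner_product_axioms, hcomplete & hseparable].

(* compact operator: linear, and maps bounded sequences to sequences
   having a convergent subsequence *)
Definition compact_op (A : H -> H) : Prop :=
  (forall (a : R[i]) (x y : H), A (a *: x + y) = a *: A x + A y) /\
  forall v : nat -> H, (forall n, hnorm (v n) <= 1) ->
    exists phi : nat -> nat, (forall n, (phi n < phi n.+1)%N) /\
      exists l : H, hcvg (fun n => A (v (phi n))) l.

Definition selfadjoint (A : H -> H) : Prop :=
  forall x y : H, ip (A x) y = ip x (A y).

Definition nonneg_op (A : H -> H) : Prop := forall x : H, 0 <= ip (A x) x.

Definition eigenvalue (A : H -> H) (z : R[i]) : Prop :=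
  exists x : H, x <> 0 /\ A x = z *: x.

(* eigenvalue whose eigenspace is one-dimensional *)
Definition simple_eigenvalue (A : H -> H) (z : R[i]) : Prop :=
  eigenvalue A z /\
  forall x y : H, x <> 0 -> A x = z *: x -> A y = z *: y ->
    exists c : R[i], y = c *: x.

(* p p^* : x |-> (x, p) p *)
Definition rank_one (p : H) : H -> H := fun x => ip x p *: p.

(* conditions (1) and (2) of the theorem for the triple (W, W1, p) *)
Definition borg_triple (lam mu : nat -> R) (W W1 : H -> H) (p : H) : Prop :=
  [/\ (* (1) *)
      [/\ selfadjoint W, nonneg_op W,
          (forall x : H, W x = 0 -> x = 0),
          compact_op W
        & (forall z : R[i], eigenvalue W z <-> exists k : nat, z = ((lam k ^+ 2)%:C)%C)
          /\ (forall k : nat, simple_eigenvalue W ((lam k ^+ 2)%:C)%C)],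
      (* (2) *)
      (forall x : H, W1 x = W x - rank_one p x),
      compact_op W1
    & (forall z : R[i], (z <> 0 /\ eigenvalue W1 z) <->
                       exists k : nat, z = ((mu k ^+ 2)%:C)%C)].

(* (u_k) is an orthonormal basis of H with W u_k = lam_k^2 u_k *)
Definition orthonormal_eigenbasis (W : H -> H) (lam : nat -> R) (u : nat -> H) : Prop :=
  [/\ forall j k : nat, ip (u j) (u k) = (j == k)%:R,
      forall x : H, (forall k, ip x (u k) = 0) -> x = 0
    & forall k : nat, W (u k) = ((lam k ^+ 2)%:C)%C *: u k].

End OneSpace.

Definition ext_sqrt (x : \bar R) : \bar R :=
  match x with
  | EFin r => (Num.sqrt r)%:E
  | EPInf => +oo%E
  | ENInf => -oo%E
  end.

(* ||W^{-1/2} p|| = (sum_k |(p,u_k)|^2 lam_k^{-2})^{1/2} in [0, +oo] *)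
Definition norm_W_mhalf (H : lmodType R[i]) (ip : H -> H -> R[i])
    (lam : nat -> R) (u : nat -> H) (p : H) : \bar R :=
  ext_sqrt (\sum_(k <oo) (cnorm2 (ip p (u k)) / lam k ^+ 2)%:E)%E.

(* ||W^{-1} p|| = (sum_k |(p,u_k)|^2 lam_k^{-4})^{1/2} in [0, +oo] *)
Definition norm_W_m1 (H : lmodType R[i]) (ip : H -> H -> R[i])
    (lam : nat -> R) (u : nat -> H) (p : H) : \bar R :=
  ext_sqrt (\sum_(k <oo) (cnorm2 (ip p (u k)) / lam k ^+ 4)%:E)%E.

(* unitary equivalence of triples (W,W1,p) on H and (W',W1',p') on H' *)
Definition unitarily_equivalent (H H' : lmodType R[i])
    (ip : H -> H -> R[i]) (ip' : H' -> H' -> R[i])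
    (W W1 : H -> H) (p : H) (W' W1' : H' -> H') (p' : H') : Prop :=
  exists (U : H -> H') (Us : H' -> H),
    [/\ forall (a : R[i]) (x y : H), U (a *: x + y) = a *: U x + U y,
        (* Us is the adjoint U^* of U *)
        forall (x : H) (y : H'), ip' (U x) y = ip x (Us y),
        (* U is unitary: U U^* = I, U^* U = I *)
        cancel Us U /\ cancel U Us
      & [/\ forall y : H', W' y = U (W (Us y)),
             forall y : H', W1' y = U (W1 (Us y))
           & p' = U p]].

End HilbertDefs.

(* Main.v *)
From HB Require Import structures.
Require Import Defs.
From mathcomp Require Import all_boot all_order all_algebra.
From mathcomp Require Import all_classical all_reals ereal topology normedtype sequences.
From mathcomp Require Import complex.
From mathcomp Require Import exp ring lra.
Import Order.TTheory GRing.Theory Num.Theory numFieldNormedType.Exports.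
Local Open Scope classical_set_scope.
Local Open Scope ring_scope.

(* Put a_k = lam_k^2, b_k = mu_k^2 and diagonalize W in an orthonormal
   eigenbasis (u_k).  The nonzero eigenvalues of W - pp^* are the zeros of the
   secular function F(z) = 1 - sum_k |(p,u_k)|^2 / (a_k - z).  With the masses
   m_k = |(p,u_k)|^2 / a_k and q = 1 - sum_k m_k, F(b_j) = 0 says that the
   probability measure sum_k m_k delta_(a_k) + q delta_0 has a Stieltjes
   transform vanishing at every b_j; that F has no negative zero gives q >= 0.

   Existence: the probability measures on {a_0, ..., a_N} whose transform is
   prod_(j < N) (x - b_j) / prod_(k <= N) (x - a_k) have masses decreasing in
   N, hence converge weakly.  Evaluating the transforms at x = -t and letting
   N -> oo, then t -> 0, compares q with prod_j b_j / a_j, and, when q = 0,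
   sum_k m_k / a_k with (1 / a_0) prod_j b_j / a_(j+1); these are the two
   criteria.

   Uniqueness of the masses: integrate
   test_fun = prod_(i <= N, i <> k) (x - a_i) / prod_(j < N) (x - b_j),
   which is 1 plus a combination of the functions 1 / (x - b_j), so that its
   integral is 1 while only the mass at a_k and a negligible tail contribute. *)

Set Implicit Arguments.
Unset Strict Implicit.
Unset Printing Implicit Defensive.

Lemma cvg_natP (R : realType) (u : nat -> R) (l : R) :
  u @ \oo --> l <->
  forall e : R, 0 < e -> exists N, forall n, (N <= n)%N -> `|u n - l| < e.
Proof.
split=> [/cvgrPdist_lt h e e0|h].
  have [N _ hN] := h e e0; exists N => n Nn.
  by rewrite distrC; apply: hN.
apply/cvgrPdist_lt => e e0; have [N hN] := h e e0.
by exists N => // n Nn /=; rewrite distrC; apply: hN.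
Qed.

Lemma cvg_big_sum (R : realType) (I : Type) (r : seq I) (f : I -> nat -> R)
    (l : I -> R) : (forall i, f i @ \oo --> l i) ->
  (fun n => \sum_(i <- r) f i n) @ \oo --> \sum_(i <- r) l i.
Proof.
move=> fl; rewrite (_ : (fun n => _) = \sum_(i <- r) f i); last first.
  by apply/funext => n; rewrite fct_sumE.
apply: (big_ind2 (fun (f : nat -> R) l => f @ \oo --> l)) => [|g m g' m'|i _].
- exact: cvg_cst.
- exact: cvgD.
- exact: fl.
Qed.

Definition bounded_sums (R : realType) (u : nat -> R) :=
  exists C, forall n, \sum_(k < n) u k <= C.

Lemma sum_ord_mono (R : realType) (u : nat -> R) m n : (forall k, 0 <= u k) ->
  (m <= n)%N -> \sum_(k < m) u k <= \sum_(k < n) u k.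
Proof.
move=> u0 mn; rewrite -!(big_mkord xpredT) [leRHS](big_cat_nat (n := m)) //= lerDl.
exact: sumr_ge0.
Qed.

Lemma bounded_sums_cvg (R : realType) (u : nat -> R) C : (forall k, 0 <= u k) ->
  (forall n, \sum_(k < n) u k <= C) ->
  exists s : R, [/\ series u @ \oo --> s, s <= C & forall n, \sum_(k < n) u k <= s].
Proof.
move=> u0 uC.
have mono : nondecreasing_seq (series u).
  by move=> m n mn; rewrite /series /= !big_mkord sum_ord_mono.
have cv : cvgn (series u).
  apply: nondecreasing_is_cvgn => //; exists C => _ [n _ <-].
  by rewrite /series /= big_mkord.
exists (limn (series u)); split => //.
  by apply: limr_le => //; apply: nearW => n; rewrite /series /= big_mkord.
by move=> n; have := nondecreasing_cvgn_le mono cv n; rewrite /series /= big_mkord.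
Qed.

Lemma prod_ge_1_sub_sum (R : realType) (x : nat -> R) m n :
  (forall k, 0 <= x k <= 1) ->
  1 - \sum_(m <= k < n) x k <= \prod_(m <= k < n) (1 - x k).
Proof.
move=> x01; have [nm|/ltnW mn] := leqP n m.
  by rewrite !big_geq // subr0.
elim: n mn => [|n IH]; first by rewrite leqn0 => /eqP->; rewrite !big_geq ?subr0.
rewrite leq_eqVlt => /orP[/eqP->|mn]; first by rewrite !big_geq ?subr0.
rewrite !big_nat_recr //=; have /andP[x0 x1] := x01 n; have := IH mn.
have : 0 <= \sum_(m <= k < n) x k by apply: sumr_ge0 => k _; case/andP: (x01 k).
set S := \sum_(_ <= _ < _) _; set P := \prod_(_ <= _ < _) _ => S0 SP.
have : 0 <= S * x n by rewrite mulr_ge0.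
have : (1 - S) * (1 - x n) <= P * (1 - x n) by rewrite ler_wpM2r ?subr_ge0.
rewrite mulrBr mulr1 mulrBl mul1r; lra.
Qed.

Lemma sum_le_prod1D (R : realType) (x : nat -> R) n : (forall k, 0 <= x k) ->
  1 + \sum_(k < n) x k <= \prod_(k < n) (1 + x k).
Proof.
move=> x0; elim: n => [|n IH]; first by rewrite !big_ord0 addr0.
rewrite !big_ord_recr /= mulrDr mulr1 addrA lerD // ler_peMl //.
by apply: le_trans IH; rewrite lerDl sumr_ge0.
Qed.

Lemma bounded_sums_prod_lb (R : realType) (x : nat -> R) :
  (forall k, 0 <= x k < 1) -> bounded_sums x ->
  exists2 P, 0 < P & forall n, P <= \prod_(k < n) (1 - x k).
Proof.
move=> x01 [C hC]; have x0 k : 0 <= x k by case/andP: (x01 k).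
have f0 k : 0 < 1 - x k by rewrite subr_gt0; case/andP: (x01 k).
have [s [xs _ les]] := bounded_sums_cvg x0 hC.
have [M hM] : exists M, s - 1 / 2 < \sum_(k < M) x k.
  have [M hM] := (cvg_natP _ _).1 xs (1 / 2) ltac:(lra).
  exists M; have := hM M (leqnn M); rewrite /series /= big_mkord ltr_norml; lra.
have PM : 0 < \prod_(k < M) (1 - x k) by exact: prodr_gt0.
exists ((\prod_(k < M) (1 - x k)) / 2) => [|n]; first by rewrite divr_gt0.
apply: (@le_trans _ _ (\prod_(k < maxn M n) (1 - x k))).
  rewrite -!(big_mkord xpredT (fun k => 1 - x k)) [leRHS](big_cat_nat (n := M)) ?leq_maxl //=.
  rewrite big_mkord ler_pM2l //.
  apply: le_trans (prod_ge_1_sub_sum _ _ _) => [|k].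
    have := les (maxn M n); rewrite -(big_mkord xpredT) (big_cat_nat (n := M)) ?leq_maxl //=.
    by rewrite big_mkord; move: hM; set A := \sum_(k < M) _; set B := \sum_(_ <= _ < _) _; lra.
  by have := x01 k => /andP[-> /ltW].
rewrite -!(big_mkord xpredT (fun k => 1 - x k)) [leLHS](big_cat_nat (n := n)) ?leq_maxr //=.
rewrite ler_piMr ?(ltW (prodr_gt0 _ _)) // prodr_ile1 // => k.
by rewrite ltW ?f0 //= gerBl.
Qed.

(** * Interlacing sequences and their masses *)

Section Masses.
Variables (R : realType) (a b : nat -> R).
Hypothesis ab : forall k, b k < a k.
Hypothesis ba : forall k, a k.+1 < b k.
Hypothesis a_gt0 : forall k, 0 < a k.
Hypothesis a_small : forall e : R, 0 < e -> exists N, a N < e.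

Lemma b_gt0 k : 0 < b k. Proof. exact: lt_trans (a_gt0 k.+1) (ba k). Qed.

Lemma a_anti i j : (i <= j)%N -> a j <= a i.
Proof.
elim: j => [|j IH]; first by rewrite leqn0 => /eqP->.
rewrite leq_eqVlt => /orP[/eqP->//|]; rewrite ltnS => /IH.
by apply: le_trans; apply: ltW; exact: lt_trans (ba j) (ab j).
Qed.

Lemma a_lt_b i j : (i < j)%N -> a j < b i.
Proof. by move=> ij; apply: le_lt_trans (ba i); apply: a_anti. Qed.

Lemma b_lt_a i j : (i <= j)%N -> b j < a i.
Proof. by move=> ij; apply: lt_le_trans (ab j) _; apply: a_anti. Qed.

Lemma a_lt i j : (i < j)%N -> a j < a i.
Proof. by move=> ij; apply: lt_trans (a_lt_b ij) (ab i). Qed.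

Lemma a_neq_b i j : a i != b j.
Proof.
have [ij|ij] := leqP i j; first by rewrite gt_eqF ?b_lt_a.
by rewrite lt_eqF ?a_lt_b.
Qed.

Lemma a_neq i j : i != j -> a i != a j.
Proof.
case: ltngtP => // ij _; first by rewrite gt_eqF ?a_lt.
by rewrite lt_eqF ?a_lt.
Qed.

Lemma a_to0 : a @ \oo --> (0 : R).
Proof.
apply/cvg_natP => e e0; have [N aN] := a_small e0; exists N => n Nn.
rewrite subr0 ger0_norm ?ltW //; exact: le_lt_trans (a_anti Nn) aN.
Qed.

(* The measure [\sum_(k <= N) approx_mass N k * delta_(a k)] is the probability measure
   with Stieltjes transform
   [\prod_(j < N) (x - b j) / \prod_(k <= N) (x - a k)]. *)
Fixpoint approx_mass (N k : nat) : R :=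
  if N is M.+1 then
    if k == N then (b M - a N) * \sum_(i < N) approx_mass M i / (a i - a N)
    else approx_mass M k * ((a k - b M) / (a k - a N))
  else (k == 0)%:R.

Lemma approx_mass_gt0 N k : (k <= N)%N -> 0 < approx_mass N k.
Proof.
elim: N k => [|N IH] k; first by rewrite leqn0 => /eqP->; rewrite /= ltr01.
move=> kN /=; case: eqP kN => [-> _|/eqP kN1 kN].
  rewrite mulr_gt0 ?subr_gt0 // big_ord_recl ltr_pwDl //.
    by rewrite divr_gt0 ?IH ?subr_gt0 ?a_lt.
  apply: sumr_ge0 => i _; rewrite ltW // divr_gt0 ?IH ?subr_gt0 ?a_lt //.
  exact: ltn_ord.
have kN' : (k <= N)%N by rewrite -ltnS ltn_neqAle kN1.
by rewrite mulr_gt0 ?IH // divr_gt0 ?subr_gt0 ?b_lt_a ?a_lt.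
Qed.

Lemma sum_approx_massS N (f : nat -> R) :
  \sum_(k < N.+2) approx_mass N.+1 k * f k =
  \sum_(k < N.+1) approx_mass N k * ((a k - b N) / (a k - a N.+1) * f k
                         + (b N - a N.+1) / (a k - a N.+1) * f N.+1).
Proof.
rewrite big_ord_recr /= eqxx mulr_sumr mulr_suml -big_split /=.
apply: eq_bigr => i _; rewrite ltn_eqF //; ring.
Qed.

Lemma sum_approx_mass N : \sum_(k < N.+1) approx_mass N k = 1.
Proof.
elim: N => [|N IH]; first by rewrite big_ord_recl big_ord0 addr0.
rewrite -[RHS]IH -[LHS](eq_bigr _ (fun i _ => mulr1 _)) (sum_approx_massS N (fun=> 1)).
apply: eq_bigr => i _; have : a i - a N.+1 != 0.
  by rewrite subr_eq0 a_neq // ltn_eqF.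
by move=> ?; field.
Qed.

Lemma stieltjes_approx_massS N (x : R) : (forall k, (k <= N.+1)%N -> x != a k) ->
  \sum_(k < N.+2) approx_mass N.+1 k / (x - a k) =
  (\sum_(k < N.+1) approx_mass N k / (x - a k)) * ((x - b N) / (x - a N.+1)).
Proof.
move=> xa; rewrite (sum_approx_massS N (fun k => (x - a k)^-1)) mulr_suml.
apply: eq_bigr => i _.
have ? : a i - a N.+1 != 0 by rewrite subr_eq0 a_neq // ltn_eqF.
have ? : x - a i != 0 by rewrite subr_eq0 xa // ltnW.
have ? : x - a N.+1 != 0 by rewrite subr_eq0 xa.
by field; apply/and3P.
Qed.

Lemma stieltjes_approx_mass_root N j : (j < N)%N ->
  \sum_(k < N.+1) approx_mass N k / (b j - a k) = 0.
Proof.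
have nz k : b j != a k by rewrite eq_sym a_neq_b.
elim: N => // N IH jN; rewrite stieltjes_approx_massS //.
move: jN; rewrite ltnS leq_eqVlt => /orP[/eqP->|/IH->]; last by rewrite mul0r.
by rewrite subrr mul0r mulr0.
Qed.

Lemma stieltjes_approx_mass_neg N (t : R) : 0 <= t -> \sum_(k < N.+1) approx_mass N k / (a k + t) =
  (a 0 + t)^-1 * \prod_(j < N) ((b j + t) / (a j.+1 + t)).
Proof.
move=> t0; have nz k : - t != a k.
  by rewrite lt_eqF // (le_lt_trans _ (a_gt0 k)) // oppr_le0.
have E M : \sum_(k < M.+1) approx_mass M k / (- t - a k) =
    - \sum_(k < M.+1) approx_mass M k / (a k + t).
  rewrite -sumrN; apply: eq_bigr => i _.
  by rewrite -opprD addrC invrN mulrN addrC.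
elim: N => [|N IH].
  by rewrite big_ord_recl !big_ord0 /= addr0 mulr1 mul1r.
apply: oppr_inj; rewrite -E stieltjes_approx_massS // E IH big_ord_recr /=.
rewrite mulNr -mulrA; congr (- (_ * (_ * _))).
by rewrite -opprD -[X in _ / X]opprD mulNr invrN mulrN opprK addrC (addrC t).
Qed.

Lemma stieltjes_approx_mass_neg_last N (t : R) : 0 <= t ->
  \sum_(k < N.+1) approx_mass N k / (a k + t) =
  (a N + t)^-1 * \prod_(j < N) ((b j + t) / (a j + t)).
Proof.
move=> t0; rewrite stieltjes_approx_mass_neg //.
have nz k : a k + t != 0 by rewrite gt_eqF // ltr_wpDr.
elim: N => [|N IH]; first by rewrite !big_ord0.
rewrite 2!big_ord_recr /= [LHS]mulrA IH; have := nz N; have := nz N.+1 => ? ?.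
set P := \prod_(j < N) _.
by field; apply/andP.
Qed.

Lemma approx_mass_leS N k : (k <= N)%N -> approx_mass N.+1 k <= approx_mass N k.
Proof.
move=> kN /=; rewrite ltn_eqF ?ltnS // ler_piMr ?ltW ?approx_mass_gt0 //.
by rewrite ltr_pdivrMr ?subr_gt0 ?a_lt // mul1r ltrD2l ltrN2 ba.
Qed.

Lemma approx_mass_le k M N : (k <= M)%N -> (M <= N)%N -> approx_mass N k <= approx_mass M k.
Proof.
move=> kM; elim: N => [|N IH]; first by rewrite leqn0 => /eqP->.
rewrite leq_eqVlt => /orP[/eqP->//|]; rewrite ltnS => MN.
by apply: le_trans (IH MN); apply: approx_mass_leS; apply: leq_trans MN.
Qed.

Lemma approx_mass_lb k N : (k < N)%N ->
  approx_mass k.+1 k * ((a k - a k.+1) / (a k - a N)) <= approx_mass N k.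
Proof.
elim: N => // N IH; rewrite ltnS leq_eqVlt => /orP[/eqP->|kN].
  by rewrite divff ?mulr1 // subr_eq0 a_neq // ltn_eqF.
have d0 : 0 < a k - a N by rewrite subr_gt0 a_lt.
have d1 : 0 < a k - a N.+1 by rewrite subr_gt0 a_lt // ltnW.
rewrite [approx_mass N.+1 k]/= ltn_eqF ?ltnS 1?ltnW //.
apply: le_trans (_ : approx_mass N k * ((a k - a N) / (a k - a N.+1)) <= _); last first.
  rewrite ler_pM2l ?approx_mass_gt0 1?ltnW // ler_pM2r ?invr_gt0 //.
  by rewrite lerD2l lerN2 ltW.
apply: le_trans (ler_wpM2r _ (IH kN)); last by rewrite ltW // divr_gt0.
rewrite -!mulrA ler_pM2l ?approx_mass_gt0 // mulrA mulrA divfK ?gt_eqF //.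
Qed.

Definition mass k : R := limn (approx_mass^~ k).

Lemma approx_mass_cvg k : approx_mass^~ k @ \oo --> mass k.
Proof.
apply: (@near_nonincreasing_is_cvgn R (approx_mass^~ k) 0).
  by exists k => // m /= km n mn; apply: approx_mass_le.
by exists k => // n /= kn; rewrite ltW ?approx_mass_gt0.
Qed.

Lemma mass_le k N : (k <= N)%N -> mass k <= approx_mass N k.
Proof.
move=> kN; apply: (cvgr_le_cst _ (@approx_mass_cvg k)) || apply: limr_le.
  by apply/cvg_ex; exists (mass k); apply: approx_mass_cvg.
by exists N => // n /= Nn; apply: approx_mass_le.
Qed.

Lemma mass_gt0 k : 0 < mass k.
Proof.
have d : 0 < a k - a k.+1 by rewrite subr_gt0 a_lt.
apply: lt_le_trans (_ : approx_mass k.+1 k * ((a k - a k.+1) / a k) <= _).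
  by rewrite mulr_gt0 ?approx_mass_gt0 // divr_gt0.
apply: limr_ge; first by apply/cvg_ex; exists (mass k); apply: approx_mass_cvg.
exists k.+1 => // n kn; apply: le_trans (approx_mass_lb kn).
rewrite ler_pM2l ?approx_mass_gt0 // ler_pM2l // lef_pV2 ?posrE ?subr_gt0 ?a_lt //.
by rewrite gerBl ltW.
Qed.

Lemma sum_mass_le n : \sum_(k < n) mass k <= 1.
Proof.
apply: (@le_trans _ _ (\sum_(k < n) approx_mass n k)).
  by apply: ler_sum => i _; apply: mass_le; apply: ltnW.
rewrite -(sum_approx_mass n) big_ord_recr /= lerDl ltW // approx_mass_gt0 //.
Qed.

Lemma weak_cvg (g : nat -> R) : g @ \oo --> (0 : R) ->
  (fun N => \sum_(k < N.+1) (approx_mass N k - mass k) * g k) @ \oo --> (0 : R).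
Proof.
move=> g0; apply/cvg_natP => e e0; have e2 : 0 < e / 2 by rewrite divr_gt0.
have [K hK] := (cvg_natP _ _).1 g0 _ e2.
have hf : (fun N => \sum_(k < K) `|(approx_mass N k - mass k) * g k|) @ \oo --> (0 : R).
  rewrite -[X in _ --> X](_ : \sum_(k < K) (0 : R) = 0); last by rewrite big1.
  apply: (cvg_big_sum (f := fun (k : 'I_K) N => `|(approx_mass N k - mass k) * g k|)) => i.
  rewrite -(normr0 R); apply: cvg_norm.
  rewrite -(mul0r (g i)); apply: cvgMr_tmp; rewrite -(subrr (mass i)).
  by apply: cvgB; [apply: approx_mass_cvg | apply: cvg_cst].
have [M hM] := (cvg_natP _ _).1 hf _ e2.
exists (maxn K M) => n; rewrite geq_max => /andP[Kn Mn].
rewrite subr0 (le_lt_trans (ler_norm_sum _ _ _)) //.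
rewrite -(big_mkord xpredT (fun k => `|(approx_mass n k - mass k) * g k|)).
rewrite (big_cat_nat (n := K)) //= 1?leqW // (splitr e) ltr_leD //.
  by have := hM n Mn; rewrite subr0 big_mkord ger0_norm ?sumr_ge0.
apply: (@le_trans _ _ (\sum_(K <= k < n.+1) approx_mass n k * (e / 2))).
  rewrite big_nat_cond [leRHS]big_nat_cond; apply: ler_sum => k.
  rewrite andbT ltnS => /andP[Kk kn]; rewrite normrM ler_pM ?normr_ge0 //.
    rewrite ger0_norm ?subr_ge0 ?mass_le // gerBl ltW // mass_gt0 //.
  by apply: ltW; have := hK k Kk; rewrite subr0.
rewrite -mulr_suml ler_piMl ?(ltW e2) //.
rewrite -[leRHS](sum_approx_mass n) -(big_mkord xpredT) /=.
rewrite [leRHS](big_cat_nat (n := K)) //= 1?leqW // lerDr.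
rewrite big_nat_cond sumr_ge0 // => k; rewrite andbT => /andP[_ kK].
by rewrite ltW // approx_mass_gt0 // (leq_trans (ltnW kK)).
Qed.

Lemma series_massE (g : nat -> R) N :
  series (fun k => mass k * g k) N.+1 =
  \sum_(k < N.+1) approx_mass N k * g k - \sum_(k < N.+1) (approx_mass N k - mass k) * g k.
Proof.
rewrite /series /= big_mkord -sumrB; apply: eq_bigr => i _; ring.
Qed.

Lemma series_mass_cvg (g : nat -> R) (l : R) : g @ \oo --> (0 : R) ->
  (fun N => \sum_(k < N.+1) approx_mass N k * g k) @ \oo --> l ->
  series (fun k => mass k * g k) @ \oo --> l.
Proof.
move=> g0 h; rewrite -cvg_shiftS; rewrite -(subr0 l).
rewrite (_ : (fun n => _) = (fun N => \sum_(k < N.+1) approx_mass N k * g k -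
  \sum_(k < N.+1) (approx_mass N k - mass k) * g k)); last first.
  by apply/funext => N; exact: series_massE.
by apply: cvgB => //; apply: weak_cvg.
Qed.

Lemma mass_secular j :
  series (fun k => mass k * (a k / (a k - b j))) @ \oo --> (1 : R).
Proof.
have nz k : a k - b j != 0 by rewrite subr_eq0 a_neq_b.
apply: series_mass_cvg.
  rewrite -(mul0r (0 - b j)^-1); apply: cvgM; first exact: a_to0.
  apply: cvgV; first by rewrite sub0r oppr_eq0 gt_eqF ?b_gt0.
  by apply: cvgB; [exact: a_to0 | exact: cvg_cst].
apply: cvg_near_cst; exists j.+1 => // N /= jN.
rewrite (eq_bigr (fun k : 'I_N.+1 => approx_mass N k - b j * (approx_mass N k / (b j - a k)))).
  by rewrite sumrB sum_approx_mass -mulr_sumr stieltjes_approx_mass_root // mulr0 subr0.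
move=> k _; have := nz k => nzk; have : b j - a k != 0.
  by rewrite -oppr_eq0 opprB.
by move=> ?; field; apply/andP.
Qed.

Lemma transform_cvg (t : R) : 0 < t ->
  (fun N => \sum_(k < N.+1) approx_mass N k / (a k + t) - \sum_(k < N.+1) mass k / (a k + t)
    - t^-1 * (1 - \sum_(k < N.+1) mass k)) @ \oo --> (0 : R).
Proof.
move=> t0; pose g k := (a k + t)^-1 - t^-1.
have g0 : g @ \oo --> (0 : R).
  rewrite -[X in _ --> X](subrr t^-1); apply: cvgB; last exact: cvg_cst.
  apply: cvgV; first by rewrite gt_eqF.
  by rewrite -[X in _ --> X]add0r; apply: cvgD; [exact: a_to0|exact: cvg_cst].
rewrite (_ : (fun N => _) = fun N => \sum_(k < N.+1) (approx_mass N k - mass k) * g k).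
  exact: weak_cvg.
apply/funext => N.
rewrite -[X in _ - _ * (X - _)](sum_approx_mass N) -[X in _ - _ * X]sumrB mulr_sumr -!sumrB.
by apply: eq_bigr => k _; rewrite /g; ring.
Qed.

Lemma prod_shift_cvg (c d : nat -> R) M : (forall k, d k != 0) ->
  (fun n => \prod_(j < M) ((c j + a n) / (d j + a n))) @ \oo -->
  \prod_(j < M) (c j / d j).
Proof.
move=> d0; elim: M => [|M IH].
  rewrite big_ord0 (_ : (fun n => _) = fun=> 1); first exact: cvg_cst.
  by apply/funext => n; rewrite big_ord0.
rewrite big_ord_recr /=.
rewrite (_ : (fun n => _) = (fun n => \prod_(j < M) ((c j + a n) / (d j + a n))
   * ((c M + a n) / (d M + a n)))); last first.
  by apply/funext => n; rewrite big_ord_recr.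
have h (x : R) : x + a n @[n --> \oo] --> x.
  by rewrite -[X in _ --> X]addr0; apply: cvgD; [exact: cvg_cst|exact: a_to0].
by apply: cvgM => //; apply: cvgM; [exact: h|apply: cvgV].
Qed.

Lemma prod_ratio_gt0 (c d : nat -> R) N : (forall k, 0 < c k) ->
  (forall k, 0 < d k) -> 0 < \prod_(j < N) (c j / d j).
Proof. by move=> c0 d0; apply: prodr_gt0 => i _; rewrite divr_gt0. Qed.

Lemma prod_ratio_le1 (c d : nat -> R) M N : (M <= N)%N -> (forall k, 0 < c k) ->
  (forall k, c k <= d k) -> \prod_(j < N) (c j / d j) <= \prod_(j < M) (c j / d j).
Proof.
move=> MN c0 cd; have d0 k : 0 < d k by exact: lt_le_trans (c0 k) (cd k).
elim: N MN => [|N IH]; first by rewrite leqn0 => /eqP->.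
rewrite leq_eqVlt => /orP[/eqP->//|/IH]; apply: le_trans.
rewrite big_ord_recr /= ler_piMr ?(ltW (prod_ratio_gt0 _ _ _)) //.
by rewrite ler_pdivrMr // mul1r.
Qed.

Lemma prod_ratio_ge1 (c d : nat -> R) M N : (M <= N)%N -> (forall k, 0 < d k) ->
  (forall k, d k <= c k) -> \prod_(j < M) (c j / d j) <= \prod_(j < N) (c j / d j).
Proof.
move=> MN d0 dc; have c0 k : 0 < c k by exact: lt_le_trans (d0 k) (dc k).
elim: N MN => [|N IH]; first by rewrite leqn0 => /eqP->.
rewrite leq_eqVlt => /orP[/eqP->//|/IH] /le_trans; apply.
rewrite big_ord_recr /= ler_peMr ?(ltW (prod_ratio_gt0 _ _ _)) //.
by rewrite ler_pdivlMr // mul1r.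
Qed.

Lemma sum_mass_le_prod (P : R) : (forall N, P <= \prod_(j < N) (b j / a j)) ->
  forall n, \sum_(k < n) mass k <= 1 - P.
Proof.
move=> hP n; have bt t : 0 < t -> P - 1 + \sum_(k < n) mass k * (a k / (a k + t)) <= 0.
  move=> t0; rewrite -(ler_pM2r (x := t^-1)) ?invr_gt0 // mul0r.
  set S := \sum_(k < n) _.
  apply: (ler_cvg_to (f := fun N => P / (a N + t) - t^-1 + S / t)
    _ (transform_cvg t0)).
    rewrite mulrDl mulrBl mul1r; apply: cvgD; last exact: cvg_cst.
    apply: cvgB; last exact: cvg_cst.
    apply: cvgMl_tmp; apply: cvgV; first by rewrite gt_eqF.
    by rewrite -[X in _ --> X]add0r; apply: cvgD; [exact: a_to0|exact: cvg_cst].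
  exists n => // N /= nN; rewrite stieltjes_approx_mass_neg_last ?(ltW t0) //.
  have hN : P <= \prod_(j < N) ((b j + t) / (a j + t)).
    apply: le_trans (hP N) _; apply: ler_prod => i _.
    rewrite ltW ?divr_gt0 ?b_gt0 //= ler_pdivrMr // mulrAC ler_pdivlMr ?addr_gt0 //.
    by rewrite mulrDr mulrDl lerD2l mulrC ler_pM2l // ltW.
  rewrite -!addrA lerD //; first by rewrite mulrC ler_pM2l // invr_gt0 addr_gt0.
  suff : S / t <= t^-1 * (\sum_(k < N.+1) mass k) - \sum_(k < N.+1) mass k / (a k + t).
    by rewrite mulrBr mulr1; set x := S / t; set y := t^-1 * _ => ?; lra.
  rewrite mulr_sumr -sumrB mulrC mulr_sumr.
  rewrite -(big_mkord xpredT (fun k => t^-1 * (mass k * (a k / (a k + t))))).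
  rewrite -(big_mkord xpredT (fun k => t^-1 * mass k - mass k / (a k + t))).
  rewrite [leRHS](big_cat_nat (n := n)) ?leqW //=.
  have E k : t^-1 * mass k - mass k / (a k + t) = t^-1 * (mass k * (a k / (a k + t))).
    by field; rewrite !gt_eqF // addr_gt0.
  rewrite (eq_bigr _ (fun k _ => E k)) lerDl sumr_ge0 // => k _.
  by rewrite E mulr_ge0 ?invr_ge0 ?(ltW t0) // mulr_ge0 ?divr_ge0 ?ltW ?mass_gt0 ?addr_gt0.
have H : (fun m => P - 1 + \sum_(k < n) mass k * (a k / (a k + a m))) @ \oo -->
    P - 1 + \sum_(k < n) mass k.
  apply: cvgD; first exact: cvg_cst.
  apply: cvg_big_sum => i.
  rewrite -[X in _ --> X]mulr1; apply: cvgMl_tmp; have nz := a_gt0 i.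
  rewrite -(divff (_ : a i != 0)) ?gt_eqF //; apply: cvgMl_tmp; apply: cvgV.
    by rewrite gt_eqF.
  by rewrite -[X in _ --> X]addr0; apply: cvgD; [exact: cvg_cst|exact: a_to0].
suff : P - 1 + \sum_(k < n) mass k <= 0 by move=> ?; lra.
apply: (ler_cvg_to H (cvg_cst _)).
by apply: nearW => m; apply: bt.
Qed.

Lemma defect_le_prod (q : R) : (forall n, \sum_(k < n) mass k <= 1 - q) ->
  forall M, q <= \prod_(j < M) (b j / a j).
Proof.
move=> hq M.
have H : (fun n => \prod_(j < M) ((b j + a n) / (a j + a n))) @ \oo -->
    \prod_(j < M) (b j / a j).
  by apply: prod_shift_cvg => k; rewrite gt_eqF.
apply: (ler_cvg_to (cvg_cst _) H).
apply: nearW => m; have t0 := a_gt0 m; set t := a m in t0 *.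
set P := \prod_(j < M) _; rewrite -subr_ge0 -(pmulr_rge0 _ (_ : 0 < t^-1)) ?invr_gt0 //.
apply: (ler_cvg_to (transform_cvg t0) (cvg_cst _)).
exists M => // N /= MN; rewrite stieltjes_approx_mass_neg_last ?(ltW t0) //.
have hN : \prod_(j < N) ((b j + t) / (a j + t)) <= P.
  apply: (prod_ratio_le1 (c := fun j => b j + t) (d := fun j => a j + t)) => // k.
    by rewrite addr_gt0 ?b_gt0.
  by rewrite lerD2r ltW.
have h1 : (a N + t)^-1 * \prod_(j < N) ((b j + t) / (a j + t)) <= t^-1 * P.
  apply: ler_pM => //; rewrite ?invr_ge0 ?addr_ge0 ?(ltW t0) ?(ltW (a_gt0 _)) //.
    by apply/ltW/(prod_ratio_gt0 (c := fun j => b j + t) (d := fun j => a j + t)) => k;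
      rewrite addr_gt0 ?b_gt0.
  by rewrite lef_pV2 ?posrE ?addr_gt0 // lerDr ltW.
have h2 : t^-1 * q <= t^-1 * (1 - \sum_(k < N.+1) mass k).
  by rewrite ler_pM2l ?invr_gt0 //; have := hq N.+1 => ?; lra.
have h3 : 0 <= \sum_(k < N.+1) mass k / (a k + t).
  by apply: sumr_ge0 => k _; rewrite divr_ge0 ?ltW ?mass_gt0 ?addr_gt0.
move: h1 h2 h3; rewrite [t^-1 * (P - q)]mulrBr; set x := t^-1 * P; set y := t^-1 * q.
by set z := t^-1 * _ => *; lra.
Qed.

Lemma sum_mass_div_le n : \sum_(k < n.+1) mass k / a k <=
  (a 0)^-1 * \prod_(j < n) (b j / a j.+1).
Proof.
have := stieltjes_approx_mass_neg n (lexx 0); rewrite addr0.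
under [in X in _ = _ * X]eq_bigr do rewrite !addr0.
move=> <-; apply: ler_sum => k _.
by rewrite addr0 ler_pM2r ?invr_gt0 // mass_le // -ltnS.
Qed.

Lemma prod_le_sum_mass_div (S : R) : series mass @ \oo --> (1 : R) ->
  (forall n, \sum_(k < n) mass k / a k <= S) ->
  forall M, (a 0)^-1 * \prod_(j < M) (b j / a j.+1) <= S.
Proof.
move=> v1 hS M.
have H : (fun m => (a 0 + a m)^-1 * \prod_(j < M) ((b j + a m) / (a j.+1 + a m)))
    @ \oo --> (a 0)^-1 * \prod_(j < M) (b j / a j.+1).
  apply: cvgM; last first.
    by apply: (prod_shift_cvg (d := fun j => a j.+1)) => k; rewrite gt_eqF.
  apply: cvgV; first by rewrite gt_eqF.
  by rewrite -[X in _ --> X]addr0; apply: cvgD; [exact: cvg_cst|exact: a_to0].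
apply: (ler_cvg_to H (cvg_cst _)).
apply: nearW => m; have t0 := a_gt0 m; set t := a m in t0 *.
set Q := _ * _; rewrite -subr_le0.
apply: (ler_cvg_to (f := fun N => Q - S - t^-1 * (1 - series mass N.+1)) _
   (transform_cvg t0)).
  rewrite -[X in _ --> X]subr0; apply: cvgB; first exact: cvg_cst.
  rewrite -(mulr0 t^-1); apply: cvgMl_tmp; rewrite -(subrr 1).
  by apply: cvgB; [exact: cvg_cst|rewrite cvg_shiftS].
exists M => // N /= MN; rewrite stieltjes_approx_mass_neg ?(ltW t0) // /series /= big_mkord.
rewrite lerD2r lerD //.
  rewrite ler_pM2l ?invr_gt0 ?addr_gt0 //.
  apply: (prod_ratio_ge1 (c := fun j => b j + t) (d := fun j => a j.+1 + t)) => // k.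
    by rewrite addr_gt0.
  by rewrite lerD2r ltW.
rewrite lerN2; apply: le_trans (hS N.+1); apply: ler_sum => k _.
by rewrite ler_pM2l ?mass_gt0 // lef_pV2 ?posrE ?addr_gt0 // lerDl ltW.
Qed.

Lemma sum_mass_eq1 : series mass @ \oo --> (1 : R) <->
  ~ bounded_sums (fun j => 1 - b j / a j).
Proof.
have r1 k : b k / a k < 1 by rewrite ltr_pdivrMr // mul1r.
have r0 k : 0 < b k / a k by rewrite divr_gt0 ?b_gt0.
have prodE n : \prod_(k < n) (1 - (1 - b k / a k)) = \prod_(k < n) (b k / a k).
  by apply: eq_bigr => k _; rewrite subKr.
have x01 k : 0 <= 1 - b k / a k < 1.
  by rewrite subr_ge0 (ltW (r1 k)) gtrBl r0.
split=> [v1 bx|nb].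
  have [P P0 hP] := bounded_sums_prod_lb x01 bx.
  have hv : forall n, \sum_(k < n) mass k <= 1 - P.
    by apply: sum_mass_le_prod => N; rewrite -prodE.
  have : 1 <= 1 - P.
    apply: (ler_cvg_to v1 (cvg_cst _)).
    by apply: nearW => n; rewrite /series /= big_mkord.
  lra.
have [s [vs s1 les]] := bounded_sums_cvg (fun k => ltW (mass_gt0 k)) sum_mass_le.
have [<-//|ns1] := eqVneq s 1; exfalso; apply: nb.
have q0 : 0 < 1 - s by rewrite subr_gt0 lt_neqAle ns1.
have hq : forall M, 1 - s <= \prod_(j < M) (b j / a j).
  by apply: defect_le_prod => n; rewrite subKr.
exists (1 - s)^-1 => n.
have x0 k : 0 <= 1 - b k / a k by case/andP: (x01 k).
apply: (@le_trans _ _ (\prod_(k < n) (1 + (1 - b k / a k)))).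
  by apply: le_trans (sum_le_prod1D n x0); rewrite lerDr.
rewrite -[leRHS]mul1r ler_pdivlMr //.
apply: le_trans (ler_wpM2l _ (hq n)) _.
  by apply: prodr_ge0 => k _; rewrite addr_ge0.
rewrite -big_split /= prodr_ile1 // => k _.
by have := r0 k; have := r1 k; set r := b k / a k => ? ?; apply/andP; split; nra.
Qed.

Lemma bounded_sums_mass_div : series mass @ \oo --> (1 : R) ->
  bounded_sums (fun k => mass k / a k) <->
  bounded_sums (fun j => b j / a j.+1 - 1).
Proof.
move=> v1; have prodE n : \prod_(k < n) (1 + (b k / a k.+1 - 1)) =
    \prod_(k < n) (b k / a k.+1).
  by apply: eq_bigr => k _; rewrite addrC subrK.
have y0 k : 0 <= b k / a k.+1 - 1.
  by rewrite subr_ge0 ler_pdivlMr // mul1r ltW.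
split=> [[S hS]|[C hC]].
  exists (a 0%N * S) => n; rewrite -ler_pdivrMl //.
  apply: le_trans (prod_le_sum_mass_div v1 hS n).
  rewrite ler_pM2l ?invr_gt0 // -prodE.
  by apply: le_trans (sum_le_prod1D n y0); rewrite lerDr.
exists ((a 0%N)^-1 * expR C) => n.
apply: (@le_trans _ _ (\sum_(k < n.+1) mass k / a k)).
  by apply: (sum_ord_mono (u := fun k => mass k / a k)) => // k; rewrite divr_ge0 ?ltW ?mass_gt0.
apply: le_trans (sum_mass_div_le n) _; rewrite ler_pM2l ?invr_gt0 //.
apply: le_trans (_ : expR (\sum_(k < n) (b k / a k.+1 - 1)) <= _); last by rewrite ler_expR.
rewrite -prodE expR_sum; apply: ler_prod => k _.
by rewrite expR_ge1Dx addr_ge0.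
Qed.

Lemma partial_fractions (c : nat -> R) N : exists d : nat -> R,
  forall x, (forall j, (j < N)%N -> x != b j) ->
    \prod_(j < N) ((x - c j) / (x - b j)) = 1 + \sum_(j < N) d j / (x - b j).
Proof.
elim: N => [|N [d IH]].
  by exists (fun=> 0) => x _; rewrite !big_ord0 addr0.
pose D := (b N - c N) * (1 + \sum_(j < N) d j / (b N - b j)).
exists (fun j => if j == N then D else d j * ((b j - c N) / (b j - b N))) => x hx.
have bN j : (j < N)%N -> b N != b j.
  by move=> jN; rewrite lt_eqF // (lt_trans (ab N)) ?a_lt_b.
rewrite !big_ord_recr /= IH; last by move=> j jN; apply: hx; apply: ltnW.
rewrite eqxx.
have -> : \sum_(i < N) (if i == N :> nat then D else d i * ((b i - c N) / (b i - b N))) / (x - b i)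
    = (\sum_(j < N) d j / (x - b j)) * ((x - c N) / (x - b N))
      - (\sum_(j < N) d j / (b N - b j)) * ((b N - c N) / (x - b N)).
  rewrite !mulr_suml -sumrB; apply: eq_bigr => j _; rewrite ltn_eqF //.
  have h1 : b N - b j != 0 by rewrite subr_eq0 bN.
  have h2 : x - b j != 0 by rewrite subr_eq0 hx // ltnS ltnW.
  have h3 : x - b N != 0 by rewrite subr_eq0 hx.
  have h4 : b j - b N != 0 by rewrite -oppr_eq0 opprB.
  by field; apply/and4P.
rewrite /D; set S := \sum_(j < N) _; set T := \sum_(j < N) _.
by have h : x - b N != 0; [rewrite subr_eq0 hx | field].
Qed.

Section Unique.
Variable u : nat -> R.
Hypothesis u_ge0 : forall k, 0 <= u k.
Hypothesis u_sum : forall n, \sum_(k < n) u k <= 1.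
Hypothesis u_secular : forall j,
  series (fun k => u k * (a k / (a k - b j))) @ \oo --> (1 : R).

Let test_fun (c : nat -> R) N x := \prod_(j < N) ((x - c j) / (x - b j)).

Lemma test_fun_series (c : nat -> R) N :
  series (fun i => u i * (test_fun c N (a i) - test_fun c N 0)) @ \oo --> 1 - test_fun c N 0.
Proof.
have [d dE] := partial_fractions c N.
have G0 : test_fun c N 0 = 1 - \sum_(j < N) d j / b j.
  rewrite /test_fun dE; last by move=> j _; rewrite lt_eqF ?b_gt0.
  by rewrite -sumrN; congr (_ + _); apply: eq_bigr => j _; rewrite sub0r invrN mulrN.
have E i : u i * (test_fun c N (a i) - test_fun c N 0) =
    \sum_(j < N) d j / b j * (u i * (a i / (a i - b j))).
  rewrite G0 /test_fun dE; last by move=> j _; rewrite a_neq_b.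
  rewrite opprB addrA addrAC [1 + _]addrC addrK -big_split /= mulr_sumr.
  apply: eq_bigr => j _; have h1 : b j != 0 by rewrite gt_eqF ?b_gt0.
  have h2 : a i - b j != 0 by rewrite subr_eq0 a_neq_b.
  by field; apply/andP.
have -> : 1 - test_fun c N 0 = \sum_(j < N) d j / b j by rewrite G0 subKr.
rewrite (_ : series _ = fun n => \sum_(j < N) d j / b j *
    series (fun i => u i * (a i / (a i - b j))) n); last first.
  apply/funext => n; rewrite /series /= (eq_bigr _ (fun i _ => E i)) exchange_big /=.
  by apply: eq_bigr => j _; rewrite mulr_sumr.
apply: (cvg_big_sum (f := fun (j : 'I_N) n => d j / b j *
    series (fun i => u i * (a i / (a i - b j))) n)) => j.
by rewrite -[X in _ --> X]mulr1; apply: cvgMl_tmp.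
Qed.

Let c k j := a (bump k j).
Let tail_bound k := \prod_(j < k) (a j / (b j - a j.+1)).

Lemma test_fun_root k N i : i != k -> (i <= N)%N -> (k <= N)%N -> test_fun (c k) N (a i) = 0.
Proof.
move=> ik iN kN; have jN : (unbump k i < N)%N.
  rewrite /unbump; have [ki|ki] := ltnP k i; first by case: i ki iN {ik} => // i _; rewrite subn1.
  by rewrite subn0 (leq_trans _ kN) // ltn_neqAle ik.
by rewrite /test_fun (bigD1 (Ordinal jN)) //= /c unbumpK ?subrr ?mul0r.
Qed.

Lemma test_fun_ge0 k N : 0 <= test_fun (c k) N (a k).
Proof.
apply: prodr_ge0 => j _; rewrite /c /bump; have [kj|jk] := leqP k j.
  by rewrite divr_ge0 ?subr_ge0 ?ltW ?a_lt ?b_lt_a.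
by rewrite -mulrNN -invrN !opprB divr_ge0 ?subr_ge0 ?ltW ?a_lt ?a_lt_b.
Qed.

Lemma test_fun_tail k N i : (k <= N)%N -> (N < i)%N ->
  0 <= test_fun (c k) N (a i) <= tail_bound k.
Proof.
move=> kN Ni.
have GE : test_fun (c k) N (a i) = \prod_(j < N) ((c k j - a i) / (b j - a i)).
  by apply: eq_bigr => j _; rewrite -mulrNN -invrN !opprB.
have bi j : (j < N)%N -> 0 < b j - a i.
  by move=> jN; rewrite subr_gt0 a_lt_b // (ltn_trans jN).
have ci j : (j < N)%N -> 0 < c k j - a i.
  move=> jN; rewrite subr_gt0 a_lt // /bump (leq_trans _ Ni) //.
  by case: (k <= j)%N; rewrite ?ltnS //= ltnW.
rewrite GE prodr_ge0 /=; last by move=> j _; rewrite divr_ge0 ?ltW ?ci ?bi.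
rewrite /tail_bound (big_ord_widen N (fun j => a j / (b j - a j.+1)) kN).
rewrite [leRHS]big_mkcond /=; apply: ler_prod => j _.
rewrite divr_ge0 ?(ltW (ci _ _)) ?(ltW (bi _ _)) //=; have := bi j (ltn_ord j).
rewrite /c /bump; have [kj|jk] := leqP k j => bij.
  by rewrite ler_pdivrMr // mul1r lerD2r ltW.
rewrite add0n; apply: ler_pM.
- by rewrite subr_ge0 ltW // a_lt // (ltn_trans _ Ni).
- by rewrite invr_ge0 ltW.
- by rewrite gerBl ltW.
- by rewrite lef_pV2 ?posrE ?bij ?subr_gt0 ?ba // lerD2l lerN2 a_anti // (ltn_trans _ Ni).
Qed.

Lemma test_fun0E k N : (k <= N)%N -> test_fun (c k) N 0 = a N / a k * \prod_(j < N) (a j / b j).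
Proof.
have GE : test_fun (c k) N 0 = \prod_(j < N) (c k j / b j).
  by apply: eq_bigr => j _; rewrite !sub0r invrN mulrNN.
rewrite GE => kN.
have E : \prod_(j < N) c k j * a k = a N * \prod_(j < N) a j.
  rewrite /c; elim: N kN {GE} => [|N IH]; first by rewrite leqn0 => /eqP->; rewrite !big_ord0 mulrC.
  rewrite leq_eqVlt => /orP[/eqP->|kN].
    rewrite mulrC; congr (_ * _); apply: eq_bigr => j _.
    by rewrite /bump leqNgt ltn_ord.
  rewrite ltnS in kN.
  by rewrite !big_ord_recr /= {2}/bump kN mulrAC IH // mulrC [a N * _]mulrC.
by rewrite !prodf_div mulrACA -E mulrA mulfK ?gt_eqF.
Qed.

Lemma test_fun_mass_cvg k : (fun N => u k * test_fun (c k) N (a k)) @ \oo --> (1 : R).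
Proof.
have [s [us s1 les]] := bounded_sums_cvg u_ge0 u_sum.
have q0 : 0 <= 1 - s by rewrite subr_ge0.
have G0_ge0 j N : (j <= N)%N -> 0 <= test_fun (c j) N 0.
  move=> jN; rewrite test_fun0E // mulr_ge0 ?divr_ge0 ?ltW //.
  by rewrite prodr_gt0 // => i _; rewrite divr_gt0 ?b_gt0.
have split_sum j N n : (j <= N)%N -> (N < n)%N ->
    series (fun i => u i * (test_fun (c j) N (a i) - test_fun (c j) N 0)) n =
    u j * test_fun (c j) N (a j) + \sum_(N.+1 <= i < n) u i * test_fun (c j) N (a i)
    - test_fun (c j) N 0 * series u n.
  move=> jN Nn; rewrite /series /= mulr_sumr.
  under eq_bigr do rewrite mulrBr [u _ * test_fun _ _ 0]mulrC.
  rewrite sumrB; congr (_ - _); rewrite (big_cat_nat (n := N.+1)) //=; congr (_ + _).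
  rewrite big_mkord (bigD1 (Ordinal (jN : j < N.+1)%N)) //= big1 ?addr0 // => i ij.
  by rewrite test_fun_root ?mulr0 // -ltnS.
have upper j N : (j <= N)%N -> u j * test_fun (c j) N (a j) <= 1 - (1 - s) * test_fun (c j) N 0.
  move=> jN; rewrite -subr_ge0.
  have h : series (fun i => u i * (test_fun (c j) N (a i) - test_fun (c j) N 0)) n
     + test_fun (c j) N 0 * series u n @[n --> \oo] -->
     1 - test_fun (c j) N 0 + test_fun (c j) N 0 * s.
    by apply: cvgD; [exact: test_fun_series|apply: cvgMl_tmp].
  have hn : \forall n \near \oo, u j * test_fun (c j) N (a j) <=
     series (fun i => u i * (test_fun (c j) N (a i) - test_fun (c j) N 0)) n
     + test_fun (c j) N 0 * series u n.
    exists N.+1 => // n /= Nn; rewrite split_sum // subrK lerDl.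
    rewrite big_nat_cond sumr_ge0 // => i; rewrite andbT => /andP[Ni _].
    by rewrite mulr_ge0 //; case/andP: (test_fun_tail jN Ni).
  have : u j * test_fun (c j) N (a j) <= 1 - test_fun (c j) N 0 + test_fun (c j) N 0 * s.
    exact: (ler_cvg_to (cvg_cst _) h hn).
  by move: (u j * _) (test_fun _ _ 0) => y z; lra.
have lower N : (k <= N)%N -> 1 - (1 - s) * test_fun (c k) N 0
     - tail_bound k * (s - series u N.+1) <= u k * test_fun (c k) N (a k).
  move=> kN.
  have h : series (fun i => u i * (test_fun (c k) N (a i) - test_fun (c k) N 0)) n
     + test_fun (c k) N 0 * series u n - tail_bound k * (series u n - series u N.+1)
      @[n --> \oo] -->
     1 - test_fun (c k) N 0 + test_fun (c k) N 0 * s - tail_bound k * (s - series u N.+1).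
    apply: cvgB; first by apply: cvgD; [exact: test_fun_series|apply: cvgMl_tmp].
    by apply: cvgMl_tmp; apply: cvgB => //; exact: cvg_cst.
  have hn : \forall n \near \oo,
     series (fun i => u i * (test_fun (c k) N (a i) - test_fun (c k) N 0)) n
     + test_fun (c k) N 0 * series u n - tail_bound k * (series u n - series u N.+1) <=
     u k * test_fun (c k) N (a k).
    exists N.+1 => // n /= Nn; rewrite split_sum // subrK -addrA gerDl subr_le0.
    rewrite sub_series_geq // mulr_sumr big_nat_cond [leRHS]big_nat_cond.
    apply: ler_sum => i; rewrite andbT => /andP[Ni _].
    by rewrite mulrC ler_wpM2r //; case/andP: (test_fun_tail kN Ni).
  have : 1 - test_fun (c k) N 0 + test_fun (c k) N 0 * s - tail_bound k * (s - series u N.+1)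
      <= u k * test_fun (c k) N (a k).
    exact: (ler_cvg_to h (cvg_cst _) hn).
  by move: (u k * _) (test_fun _ _ 0) (tail_bound k * _) => y z x; lra.
(* The case [k = N] bounds the contribution of the mass [1 - s] at 0. *)
have qG N : (k <= N)%N -> (1 - s) * test_fun (c k) N 0 <= a N / a k.
  move=> kN; have := upper N N (leqnn N).
  have : 0 <= u N * test_fun (c N) N (a N) by rewrite mulr_ge0 ?test_fun_ge0.
  rewrite !test_fun0E // divff ?gt_eqF // mul1r => h1 h2.
  by rewrite mulrCA ler_piMr ?divr_ge0 ?(ltW (a_gt0 _)) //; lra.
apply: (@squeeze_cvgr _ _ _ _ (fun N => 1 - a N / a k - tail_bound k * (s - series u N.+1))
   (fun=> 1)).
- exists k => // N /= kN; have := upper k N kN; have := lower N kN; have := qG N kN.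
  have := mulr_ge0 q0 (G0_ge0 k N kN); lra.
- rewrite -[X in _ --> X]subr0 -[X in X - 0]subr0; apply: cvgB; first apply: cvgB.
  + exact: cvg_cst.
  + by rewrite -(mul0r (a k)^-1); apply: cvgMr_tmp; exact: a_to0.
  + rewrite -(mulr0 (tail_bound k)); apply: cvgMl_tmp; rewrite -(subrr s).
    by apply: cvgB; [exact: cvg_cst|rewrite cvg_shiftS].
- exact: cvg_cst.
Qed.

End Unique.

Lemma secular_unique (u u' : nat -> R) :
  (forall k, 0 <= u k) -> (forall n, \sum_(k < n) u k <= 1) ->
  (forall j, series (fun k => u k * (a k / (a k - b j))) @ \oo --> (1 : R)) ->
  (forall k, 0 <= u' k) -> (forall n, \sum_(k < n) u' k <= 1) ->
  (forall j, series (fun k => u' k * (a k / (a k - b j))) @ \oo --> (1 : R)) ->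
  u = u'.
Proof.
move=> u0 us useq u'0 u's u'seq; apply/funext => k.
have h := test_fun_mass_cvg u0 us useq k; have h' := test_fun_mass_cvg u'0 u's u'seq k.
pose X N := \prod_(j < N) ((a k - a (bump k j)) / (a k - b j)).
have h1 : (fun N => u' k * (u k * X N)) @ \oo --> u' k.
  by rewrite -[X in _ --> X]mulr1; apply: cvgMl_tmp.
have h2 : (fun N => u k * (u' k * X N)) @ \oo --> u k.
  by rewrite -[X in _ --> X]mulr1; apply: cvgMl_tmp.
rewrite -[LHS](cvg_lim _ h2) // -[RHS](cvg_lim _ h1) //.
congr (limn _); apply/funext => N; exact: mulrCA.
Qed.

End Masses.

Lemma secular_bound (R : realType) (a w : nat -> R) (C : R) :
  (forall k, 0 < a k) -> (forall k, 0 <= w k) ->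
  (forall n, \sum_(k < n) w k <= C) ->
  (forall t : R, 0 < t ->
     ~ (series (fun k => w k / (a k + t)) @ \oo --> (1 : R))) ->
  forall n, \sum_(k < n) w k / a k <= 1.
Proof.
move=> a0 w0 wC hne n; rewrite leNgt; apply/negP => h1.
have [t0 t0_gt0 ht0] : exists2 t0 : R, 0 < t0 & 1 < \sum_(k < n) w k / (a k + t0).
  have H : (fun m => \sum_(k < n) w k / (a k + harmonic m)) @ \oo --> \sum_(k < n) w k / a k.
    apply: (cvg_big_sum (f := fun (k : 'I_n) m => w k / (a k + harmonic m))) => k.
    apply: cvgMl_tmp; apply: cvgV; first by rewrite gt_eqF.
    rewrite -[X in _ --> X]addr0; apply: cvgD; first exact: cvg_cst.
    exact: cvg_harmonic.
  have [M hM] := (cvg_natP _ _).1 H _ (etrans (subr_gt0 _ _) h1).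
  exists (harmonic M); first exact: harmonic_gt0.
  by have := hM M (leqnn M); rewrite ltr_norml; lra.
have C0 : 0 <= C by have := wC 0%N; rewrite big_ord0.
pose g (x : R) k := w k / (a k + Num.max x t0).
have den x k : 0 < a k + Num.max x t0 by rewrite addr_gt0 // lt_max t0_gt0 orbT.
have g0 x k : 0 <= g x k by rewrite divr_ge0 // ltW.
have gC x m : \sum_(k < m) g x k <= C / Num.max x t0.
  rewrite ler_pdivlMr ?lt_max ?t0_gt0 ?orbT // mulr_suml; apply: le_trans (wC m).
  apply: ler_sum => k _; rewrite /g -mulrA ler_piMr //.
  by rewrite mulrC ler_pdivrMr // mul1r lerDr ltW.
have gcv x : {s : R | series (g x) @ \oo --> s}.
  by apply: cid; have [s [? _ _]] := bounded_sums_cvg (g0 x) (gC x); exists s.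
pose f x := sval (gcv x).
have fE x : series (g x) @ \oo --> f x by exact: (svalP (gcv x)).
have lip (x y : R) : `|f x - f y| <= `|x - y| * (C / t0 ^+ 2).
  have H : `|series (g x) m - series (g y) m| @[m --> \oo] --> `|f x - f y|.
    by apply: cvg_norm; apply: cvgB.
  apply: (ler_cvg_to H (cvg_cst _)); apply: nearW => m.
  rewrite /series /= -sumrB; apply: le_trans (ler_norm_sum _ _ _) _.
  rewrite big_mkord mulrA ler_pdivlMr ?exprn_gt0 // mulr_suml.
  apply: le_trans (ler_wpM2l (normr_ge0 _) (wC m)); rewrite mulr_sumr.
  apply: ler_sum => k _.
  have -> : g x k - g y k = w k * (Num.max y t0 - Num.max x t0) /
      ((a k + Num.max x t0) * (a k + Num.max y t0)).
    by rewrite /g; have := den x k; have := den y k => ? ?; field; rewrite !gt_eqF.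
  rewrite !normrM normfV (ger0_norm (w0 k)) (gtr0_norm (mulr_gt0 (den x k) (den y k))).
  have hm : `|Num.max y t0 - Num.max x t0| <= `|x - y|.
    rewrite distrC !maxEle; case: (leP x t0) => xt; case: (leP y t0) => yt.
    - by rewrite subrr normr0.
    - by rewrite distrC [leRHS]distrC !ger0_norm; lra.
    - by rewrite !ger0_norm; lra.
    - by [].
  set D := (a k + _) * _; set m' := `|_ - _| in hm *.
  have tD : t0 ^+ 2 / D <= 1.
    rewrite ler_pdivrMr ?mulr_gt0 // mul1r expr2.
    have mx z : t0 <= a k + Num.max z t0.
      by rewrite ler_wpDl ?(ltW (a0 k)) // le_max lexx orbT.
    by rewrite ler_pM ?(ltW t0_gt0).
  rewrite (_ : _ * t0 ^+ 2 = m' * w k * (t0 ^+ 2 / D)); last by ring.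
  apply: le_trans (_ : m' * w k <= _); last by rewrite ler_wpM2r.
  by rewrite ler_piMr // mulr_ge0 // normr_ge0.
have cf : continuous f.
  have K0 : 0 < C / t0 ^+ 2 + 1 by rewrite ltr_wpDl // divr_ge0 // exprn_ge0 // ltW.
  move=> x; apply/cvgrPdist_le => e e0.
  near=> y; apply: le_trans (lip x y) _.
  apply: (@le_trans _ _ (`|x - y| * (C / t0 ^+ 2 + 1))); first by rewrite ler_wpM2l // lerDl.
  rewrite -ler_pdivlMr //; near: y.
  by apply: (@cvgr_dist_le _ _ _ _ _ id); [exact: cvg_id | rewrite divr_gt0].
have [T [tT hT]] : exists T : R, t0 <= T /\ C / T < 1.
  exists (t0 + C + 1); split; first by lra.
  by rewrite ltr_pdivrMr; lra.
have f1 : 1 <= f t0.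
  apply: (ler_cvg_to (cvg_cst _) (fE t0)); exists n => // m /= nm.
  rewrite /series /= big_mkord; apply: le_trans (sum_ord_mono (g0 t0) nm).
  by rewrite /g maxxx ltW.
have fT : f T <= 1.
  apply: (ler_cvg_to (fE T) (cvg_cst _)); apply: nearW => m.
  rewrite /series /= big_mkord; apply: le_trans (gC T m) _.
  by rewrite max_l // ltW.
have [x xT fx] : exists2 x, x \in `[t0, T] & f x = 1.
  apply: IVT => //; first exact: continuous_subspaceT.
  by rewrite ge_min fT orbT le_max f1.
move: xT; rewrite in_itv /= => /andP[tx _].
apply: (hne x); first exact: lt_le_trans tx.
rewrite -fx; have := fE x; rewrite (_ : g x = fun k => w k / (a k + x)) //.
by apply/funext => k; rewrite /g max_l.
Unshelve. all: by end_near. Qed.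

(** * Inner product spaces *)

Section ComplexSeq.
Variable R : realType.
Implicit Types (z w : R[i]) (f g : nat -> R[i]).
Local Notation Re := complex.Re.
Local Notation Im := complex.Im.

Lemma cReD z w : Re (z + w) = Re z + Re w. Proof. by case: z; case: w. Qed.
Lemma cImD z w : Im (z + w) = Im z + Im w. Proof. by case: z; case: w. Qed.
Lemma cReM z w : Re (z * w) = Re z * Re w - Im z * Im w.
Proof. by case: z; case: w. Qed.
Lemma cImM z w : Im (z * w) = Re z * Im w + Im z * Re w.
Proof. by case: z; case: w. Qed.
Lemma cReJ z : Re (z^*)%C = Re z. Proof. by case: z. Qed.
Lemma cImJ z : Im (z^*)%C = - Im z. Proof. by case: z. Qed.

Lemma complex_ext z w : Re z = Re w -> Im z = Im w -> z = w.
Proof. by case: z => ? ?; case: w => ? ? /= -> ->. Qed.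

Lemma cnorm2_ge0 z : 0 <= cnorm2 z.
Proof. by rewrite addr_ge0 ?sqr_ge0. Qed.

Lemma cnorm2_0 : cnorm2 (0 : R[i]) = 0.
Proof. by rewrite /cnorm2 /= expr0n /= addr0. Qed.

Lemma cnorm2_eq0 z : cnorm2 z = 0 -> z = 0.
Proof.
rewrite /cnorm2 => /eqP; rewrite paddr_eq0 ?sqr_ge0 // !sqrf_eq0.
by case/andP => /eqP ? /eqP ?; apply: complex_ext.
Qed.

Lemma cnorm2_gt0 z : z != 0 -> 0 < cnorm2 z.
Proof.
move=> z0; rewrite lt_neqAle cnorm2_ge0 andbT eq_sym.
by apply: contra z0 => /eqP /cnorm2_eq0 ->.
Qed.

Lemma cnorm2M z w : cnorm2 (z * w) = cnorm2 z * cnorm2 w.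
Proof. by rewrite /cnorm2 cReM cImM; ring. Qed.

Lemma cnorm2J z : cnorm2 (z^*)%C = cnorm2 z.
Proof. by rewrite /cnorm2 cReJ cImJ sqrrN. Qed.

Lemma cnorm2N z : cnorm2 (- z) = cnorm2 z.
Proof. by case: z => x y; rewrite /cnorm2 /= !sqrrN. Qed.

Lemma cnorm2R (r : R) : cnorm2 (r%:C)%C = r ^+ 2.
Proof. by rewrite /cnorm2 /= expr0n addr0. Qed.

Lemma mulcJ z : z * (z^*)%C = ((cnorm2 z)%:C)%C.
Proof. by apply: complex_ext; rewrite ?cReM ?cImM ?cReJ ?cImJ /= /cnorm2; ring. Qed.

Lemma cnorm2D z w : cnorm2 (z + w) <= 2 * (cnorm2 z + cnorm2 w).
Proof.
rewrite /cnorm2 cReD cImD; have := sqr_ge0 (Re z - Re w).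
by have := sqr_ge0 (Im z - Im w); nra.
Qed.

Lemma cRe_sum (I : Type) (r : seq I) (f : I -> R[i]) :
  Re (\sum_(i <- r) f i) = \sum_(i <- r) Re (f i).
Proof. by elim/big_rec2: _ => // i x z _ <-; rewrite cReD. Qed.

Lemma cIm_sum (I : Type) (r : seq I) (f : I -> R[i]) :
  Im (\sum_(i <- r) f i) = \sum_(i <- r) Im (f i).
Proof. by elim/big_rec2: _ => // i x z _ <-; rewrite cImD. Qed.

Definition ccvg f z :=
  (fun n => Re (f n)) @ \oo --> Re z /\ (fun n => Im (f n)) @ \oo --> Im z.

Lemma ccvg_unique f z w : ccvg f z -> ccvg f w -> z = w.
Proof.
move=> [fz1 fz2] [fw1 fw2]; apply: complex_ext.
  by rewrite -(cvg_lim _ fz1) // -(cvg_lim _ fw1).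
by rewrite -(cvg_lim _ fz2) // -(cvg_lim _ fw2).
Qed.

Lemma ccvgD f g z w : ccvg f z -> ccvg g w -> ccvg (fun n => f n + g n) (z + w).
Proof.
move=> [f1 f2] [g1 g2]; split.
  by rewrite cReD; under eq_cvg do rewrite cReD; apply: cvgD.
by rewrite cImD; under eq_cvg do rewrite cImD; apply: cvgD.
Qed.

Lemma ccvgZ (c : R[i]) f z : ccvg f z -> ccvg (fun n => c * f n) (c * z).
Proof.
move=> [f1 f2]; split.
  rewrite cReM; under eq_cvg do rewrite cReM.
  by apply: cvgB; apply: cvgMl_tmp.
rewrite cImM; under eq_cvg do rewrite cImM.
by apply: cvgD; apply: cvgMl_tmp.
Qed.

Lemma ccvgJ f z : ccvg f z -> ccvg (fun n => (f n)^*%C) (z^*)%C.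
Proof.
move=> [f1 f2]; split.
  by rewrite cReJ; under eq_cvg do rewrite cReJ.
by rewrite cImJ; under eq_cvg do rewrite cImJ; apply: cvgN.
Qed.

Lemma ccvg_cst z : ccvg (fun=> z) z.
Proof. by split; apply: cvg_cst. Qed.

Lemma Re_le_cnorm2 z : `|Re z| <= Num.sqrt (cnorm2 z).
Proof. by rewrite -sqrtr_sqr ler_wsqrtr // lerDl sqr_ge0. Qed.

Lemma Im_le_cnorm2 z : `|Im z| <= Num.sqrt (cnorm2 z).
Proof. by rewrite -sqrtr_sqr ler_wsqrtr // lerDr sqr_ge0. Qed.

Lemma sqrt_cvg0 (h : nat -> R) : h @ \oo --> (0 : R) ->
  (fun n => Num.sqrt (h n)) @ \oo --> (0 : R).
Proof.
move=> /cvg_natP h0; apply/cvg_natP => e e0.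
have [N hN] := h0 (e ^+ 2) (exprn_gt0 _ e0); exists N => n Nn.
rewrite subr0 ger0_norm ?sqrtr_ge0 // -(ger0_norm (ltW e0)) -sqrtr_sqr.
rewrite ltr_sqrt ?exprn_gt0 //.
by have := hN n Nn; rewrite subr0; apply: le_lt_trans; apply: ler_norm.
Qed.

Lemma ccvg_of_cnorm2 f z : (fun n => cnorm2 (f n - z)) @ \oo --> (0 : R) -> ccvg f z.
Proof.
move=> /sqrt_cvg0 /cvg_natP h; split; apply/cvg_natP => e e0;
  have [N hN] := h e e0; exists N => n Nn; have := hN n Nn;
  rewrite subr0 ger0_norm ?sqrtr_ge0 //; apply: le_lt_trans.
- by have := Re_le_cnorm2 (f n - z); case: (f n) => ? ?; case: (z).
- by have := Im_le_cnorm2 (f n - z); case: (f n) => ? ?; case: (z).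
Qed.

Lemma cnorm2_cvg f z : ccvg f z -> (fun n => cnorm2 (f n)) @ \oo --> cnorm2 z.
Proof.
by move=> [f1 f2]; apply: cvgD; rewrite expr2; under eq_cvg do rewrite expr2;
  apply: cvgM.
Qed.

End ComplexSeq.

Lemma diagonal_subsequence (R : realType) (f : nat -> nat -> R) :
  (forall n i, -1 <= f n i <= 1) ->
  exists2 phi : nat -> nat, (forall n, (phi n < phi n.+1)%N) &
    exists g : nat -> R, forall i, (fun n => f (phi n) i) @ \oo --> g i.
Proof.
move=> f1; pose P := prod_topology (fun _ : nat => R).
have FA : ((f : nat -> P) @ \oo) [set h | forall i, `[-1, 1]%classic (h i)].
  by exists 0%N => // n _ i /=; rewrite in_itv /=; apply: f1.
have [g [_ clg]] := @tychonoff nat (fun=> R) (fun=> `[-1, 1]%classic)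
  (fun=> @segment_compact R (-1) 1) ((f : nat -> P) @ \oo) _ FA.
have nb m (e : R) : 0 < e ->
    nbhs (g : P) [set h : P | forall i, (i < m)%N -> `|h i - g i| < e].
  move=> e0; elim: m => [|m IH].
    by apply: filterS (@filterT _ (nbhs (g : P)) _) => h _ i.
  have hm := @proj_continuous nat (fun=> R) m g _ (nbhsx_ballx (g m) e e0).
  apply: filterS (filterI IH hm) => h [h1 h2] i.
  rewrite ltnS leq_eqVlt => /orP[/eqP->|/h1//]; rewrite distrC.
  by have := h2; rewrite /preimage /= -ball_normE.
have step (Nm : nat * nat) : exists n, (Nm.1 <= n)%N /\
    forall i, (i < Nm.2)%N -> `|f n i - g i| < (Nm.2.+1%:R)^-1.
  case: Nm => N m /=.
  have FN : ((f : nat -> P) @ \oo) [set h | exists2 n, (N <= n)%N & h = f n].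
    by exists N => // n /= Nn; exists n.
  have e0 : 0 < (m.+1%:R : R)^-1 by rewrite invr_gt0.
  by have [_ [[n Nn ->] hn]] := clg _ _ FN (nb m _ e0); exists n.
have [s sP] := choice step.
pose phi := fix phi n := if n is m.+1 then s ((phi m).+1, m.+1) else s (0%N, 0%N).
exists phi => [n|]; first by have [] := sP ((phi n).+1, n.+1).
exists g => i; apply/cvg_natP => e e0.
have [M hM] := (cvg_natP _ _).1 (@cvg_harmonic R) e e0.
exists (maxn M i.+1) => n; rewrite geq_max => /andP[Mn ni].
have := hM n Mn; rewrite subr0 ger0_norm ?harmonic_ge0 //; apply: lt_trans.
by case: n ni {Mn} => // n ni; have [_] := sP ((phi n).+1, n.+1); apply.
Qed.

Section Inner.
Variables (R : realType) (H : lmodType R[i]) (ip : H -> H -> R[i]).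
Hypothesis ipP : inner_product_axioms ip.
Local Notation Re := complex.Re.
Local Notation Im := complex.Im.

Lemma ip_lin (a : R[i]) x y z : ip (a *: x + y) z = a * ip x z + ip y z.
Proof. by case: ipP. Qed.

Lemma ipC x y : ip y x = ((ip x y)^*)%C.
Proof. by case: ipP. Qed.

Lemma ipDl x y z : ip (x + y) z = ip x z + ip y z.
Proof. by rewrite -[x]scale1r ip_lin mul1r scale1r. Qed.

Lemma ip0l z : ip 0 z = 0.
Proof. by apply: (addrI (ip 0 z)); rewrite -ipDl !addr0. Qed.

Lemma ipZl (a : R[i]) x z : ip (a *: x) z = a * ip x z.
Proof. by rewrite -[a *: x]addr0 ip_lin ip0l addr0. Qed.

Lemma ipNl x z : ip (- x) z = - ip x z.
Proof. by rewrite -scaleN1r ipZl mulN1r. Qed.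

Lemma ipBl x y z : ip (x - y) z = ip x z - ip y z.
Proof. by rewrite ipDl ipNl. Qed.

Lemma ipDr x y z : ip z (x + y) = ip z x + ip z y.
Proof. by rewrite ipC ipDl rmorphD /= -!ipC. Qed.

Lemma ip0r z : ip z 0 = 0.
Proof. by rewrite ipC ip0l rmorph0. Qed.

Lemma ipZr (a : R[i]) x z : ip z (a *: x) = (a^*)%C * ip z x.
Proof. by rewrite ipC ipZl rmorphM /= -ipC. Qed.

Lemma ipNr x z : ip z (- x) = - ip z x.
Proof. by rewrite ipC ipNl rmorphN /= -ipC. Qed.

Lemma ipBr x y z : ip z (x - y) = ip z x - ip z y.
Proof. by rewrite ipDr ipNr. Qed.

Lemma ip_suml (I : Type) (r : seq I) (f : I -> H) z :
  ip (\sum_(i <- r) f i) z = \sum_(i <- r) ip (f i) z.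
Proof. exact: (big_morph (fun x => ip x z) (fun x y => ipDl x y z) (ip0l z)). Qed.

Definition norm2 x : R := Re (ip x x).

Lemma ipxx x : ip x x = ((norm2 x)%:C)%C.
Proof.
apply: complex_ext => //=; have : 0 <= ip x x by case: ipP.
by rewrite lecE => /andP[/eqP ->].
Qed.

Lemma norm2_ge0 x : 0 <= norm2 x.
Proof.
have : 0 <= ip x x by case: ipP.
by rewrite lecE => /andP[_].
Qed.

Lemma norm2_eq0 x : norm2 x = 0 -> x = 0.
Proof. by move=> h; case: ipP => _ _ _; apply; rewrite ipxx h. Qed.

Lemma norm2_gt0 x : x <> 0 -> 0 < norm2 x.
Proof.
by move=> x0; rewrite lt_neqAle norm2_ge0 andbT eq_sym; apply/eqP => /norm2_eq0.
Qed.

Lemma norm2_0 : norm2 0 = 0. Proof. by rewrite /norm2 ip0l. Qed.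

Lemma norm2D x y : norm2 (x + y) = norm2 x + norm2 y + 2 * Re (ip x y).
Proof.
rewrite /norm2 ipDl !ipDr !cReD [ip y x]ipC cReJ; ring.
Qed.

Lemma norm2N x : norm2 (- x) = norm2 x.
Proof. by rewrite /norm2 ipNl ipNr opprK. Qed.

Lemma norm2B x y : norm2 (x - y) = norm2 x + norm2 y - 2 * Re (ip x y).
Proof. by rewrite norm2D norm2N ipNr; case: (ip x y) => c d /=; ring. Qed.

Lemma norm2Z (a : R[i]) x : norm2 (a *: x) = cnorm2 a * norm2 x.
Proof. by rewrite /norm2 ipZl ipZr mulrA mulcJ ipxx cReM /= mul0r subr0. Qed.

Lemma norm2_add_le x y : norm2 (x + y) <= 2 * (norm2 x + norm2 y).
Proof. by have := norm2_ge0 (x - y); rewrite norm2B norm2D; lra. Qed.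

Lemma norm2_sub_le x y : norm2 (x - y) <= 2 * (norm2 x + norm2 y).
Proof. by rewrite -[norm2 y]norm2N norm2_add_le. Qed.

Lemma cauchy_schwarz x y : cnorm2 (ip x y) <= norm2 x * norm2 y.
Proof.
have [->|/eqP/norm2_gt0 y0] := eqVneq y 0; first by rewrite ip0r cnorm2_0 norm2_0 mulr0.
pose r := (norm2 y)^-1; have r0 : 0 < r by rewrite invr_gt0.
have := norm2_ge0 (x - ((r%:C)%C * ip x y) *: y).
rewrite norm2B norm2Z cnorm2M ipZr cnorm2R.
have -> : Re (((r%:C)%C * ip x y)^*%C * ip x y) = r * cnorm2 (ip x y).
  by rewrite !(cReM, cImM, cReJ, cImJ) /= /cnorm2; ring.
set N := norm2 y in r r0 y0 *; set C := cnorm2 _ => h.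
have : 0 <= norm2 x - C / N.
  apply: le_trans h _; rewrite le_eqVlt; apply/orP; left; apply/eqP.
  by rewrite /r; field; rewrite gt_eqF.
by rewrite subr_ge0 ler_pdivrMr.
Qed.

Lemma hnorm_ge0 x : 0 <= hnorm ip x. Proof. exact: sqrtr_ge0. Qed.

Lemma hnorm2 x : hnorm ip x ^+ 2 = norm2 x.
Proof. by rewrite sqr_sqrtr ?norm2_ge0. Qed.

Lemma hnorm_lt x (e : R) : 0 < e -> (hnorm ip x < e) = (norm2 x < e ^+ 2).
Proof.
by move=> e0; rewrite -hnorm2 ltr_pXn2r // nnegrE ?hnorm_ge0 ?ltW.
Qed.

Lemma hnorm_le x (e : R) : 0 <= e -> (hnorm ip x <= e) = (norm2 x <= e ^+ 2).
Proof.
by move=> e0; rewrite -hnorm2 ler_pXn2r // nnegrE hnorm_ge0.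
Qed.

Lemma hcvgP (v : nat -> H) l :
  hcvg ip v l <-> (fun n => norm2 (v n - l)) @ \oo --> (0 : R).
Proof.
split=> [h|/cvg_natP h].
  apply/cvg_natP => e e0; have [|N hN] := h (Num.sqrt e); first by rewrite sqrtr_gt0.
  exists N => n Nn; rewrite subr0 ger0_norm ?norm2_ge0 //.
  by have := hN n Nn; rewrite hnorm_lt ?sqrtr_gt0 // sqr_sqrtr // ltW.
move=> e e0; have [N hN] := h _ (exprn_gt0 2 e0); exists N => n Nn.
by rewrite hnorm_lt //; have := hN n Nn; rewrite subr0 ger0_norm ?norm2_ge0.
Qed.

Lemma norm2_squeeze (f g : nat -> R) : (forall n, 0 <= f n <= g n) ->
  g @ \oo --> (0 : R) -> f @ \oo --> (0 : R).
Proof.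
move=> fg g0; apply: (squeeze_cvgr _ (cvg_cst 0) g0).
by apply: nearW.
Qed.

Lemma hcvg_unique v l l' : hcvg ip v l -> hcvg ip v l' -> l = l'.
Proof.
move=> /hcvgP h /hcvgP h'; apply/eqP; rewrite -subr_eq0; apply/eqP/norm2_eq0.
have : (fun=> norm2 (l - l')) @ \oo --> (0 : R).
  apply: (norm2_squeeze (g := fun n => 2 * (norm2 (v n - l) + norm2 (v n - l')))).
    move=> n; have -> : l - l' = (v n - l') - (v n - l).
      by rewrite opprB [RHS]addrC addrA subrK.
    by rewrite norm2_ge0 /= [in leRHS]addrC norm2_sub_le.
  rewrite -(mulr0 2); apply: cvgMl_tmp; rewrite -(addr0 0); exact: cvgD.
by move=> h0; apply: esym; rewrite -(cvg_lim _ h0) // lim_cst.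
Qed.

Lemma ip_hcvg v l y : hcvg ip v l -> ccvg (fun n => ip (v n) y) (ip l y).
Proof.
move=> /hcvgP h; apply: ccvg_of_cnorm2.
apply: (norm2_squeeze (g := fun n => norm2 (v n - l) * norm2 y)).
  by move=> n; rewrite cnorm2_ge0 -ipBl cauchy_schwarz.
by rewrite -(mul0r (norm2 y)); apply: cvgMr_tmp.
Qed.

Lemma norm2_hcvg v l : hcvg ip v l -> (fun n => norm2 (v n)) @ \oo --> norm2 l.
Proof.
move=> h; have /hcvgP h2 := h; have [h1 _] := ip_hcvg l h.
have E n : norm2 (v n) = norm2 (v n - l) - norm2 l + 2 * Re (ip (v n) l).
  by rewrite norm2B; ring.
have L : (fun n => norm2 (v n - l) - norm2 l + 2 * Re (ip (v n) l)) @ \oo -->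
    0 - norm2 l + 2 * Re (ip l l).
  apply: cvgD; last exact: cvgMl_tmp.
  by apply: cvgB => //; exact: cvg_cst.
rewrite (_ : (fun n => _) = fun n => norm2 (v n - l) - norm2 l + 2 * Re (ip (v n) l)).
  by move: L; rewrite (_ : 0 - _ + _ = norm2 l) // /norm2; ring.
by apply/funext => n; exact: E.
Qed.

Definition complete_orthonormal (u : nat -> H) :=
  (forall j k : nat, ip (u j) (u k) = (j == k)%:R) /\
  (forall x : H, (forall k, ip x (u k) = 0) -> x = 0).

Section Orthonormal.
Variable u : nat -> H.
Hypothesis uP : forall j k : nat, ip (u j) (u k) = (j == k)%:R.

Lemma ip_sum_onb (c : nat -> R[i]) n k :
  ip (\sum_(j < n) c j *: u j) (u k) = if (k < n)%N then c k else 0.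
Proof.
rewrite (ip_suml _ (fun j : 'I_n => c j *: u j)).
under eq_bigr do rewrite ipZl uP; case: ltnP => kn.
  rewrite (bigD1 (Ordinal kn)) //= eqxx mulr1 big1 ?addr0 // => j jk.
  by rewrite (_ : (j == k :> nat) = false) ?mulr0 //; apply: negbTE.
by rewrite big1 // => j _; rewrite ltn_eqF ?mulr0 // (leq_trans _ kn).
Qed.

Lemma norm2_sum_onb (c : nat -> R[i]) m n :
  norm2 (\sum_(m <= j < n) c j *: u j) = \sum_(m <= j < n) cnorm2 (c j).
Proof.
have [nm|/ltnW mn] := leqP n m; first by rewrite !big_geq ?norm2_0.
elim: n mn => [|n IH]; first by rewrite leqn0 => /eqP->; rewrite !big_geq ?norm2_0.
rewrite leq_eqVlt => /orP[/eqP->|mn]; first by rewrite !big_geq ?norm2_0.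
rewrite !big_nat_recr //= norm2D IH // norm2Z [norm2 (u n)]/norm2 uP eqxx mulr1.
rewrite ipZr [ip _ _](_ : _ = 0) ?mulr0 ?addr0 //.
rewrite ip_suml big_nat_cond big1 // => j; rewrite andbT => /andP[_ jn].
by rewrite ipZl uP ltn_eqF ?mulr0.
Qed.

Lemma ip_proj_onb x n :
  ip x (\sum_(j < n) ip x (u j) *: u j) = ((\sum_(j < n) cnorm2 (ip x (u j)))%:C)%C.
Proof.
rewrite ipC ip_suml rmorph_sum /= rmorph_sum; apply: eq_bigr => j _.
by rewrite ipZl rmorphM /= -[(ip (u j) x)^*%C]ipC mulrC mulcJ.
Qed.

Lemma bessel x n : \sum_(j < n) cnorm2 (ip x (u j)) <= norm2 x.
Proof.
have := norm2_ge0 (x - \sum_(j < n) ip x (u j) *: u j).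
rewrite norm2B ip_proj_onb /= -(big_mkord xpredT (fun j => ip x (u j) *: u j)).
by rewrite norm2_sum_onb big_mkord; lra.
Qed.

Hypothesis cplt : hcomplete ip.

Lemma riesz_fischer (c : nat -> R[i]) : bounded_sums (fun k => cnorm2 (c k)) ->
  exists x, hcvg ip (fun n => \sum_(k < n) c k *: u k) x /\
            forall k, ip x (u k) = c k.
Proof.
move=> [C hC]; have [s [cs _ les]] := bounded_sums_cvg (fun k => cnorm2_ge0 (c k)) hC.
have [|x hx] := cplt (v := fun n => \sum_(k < n) c k *: u k).
  move=> e e0; have [N hN] := (cvg_natP _ _).1 cs _ (exprn_gt0 2 e0).
  exists N => m n Nm Nn; wlog nm : m n Nm Nn / (n <= m)%N.
    move=> h; have [/h->//|/ltnW/h h'] := leqP n m.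
    by rewrite hnorm_lt // -norm2N opprB -hnorm_lt // h'.
  rewrite hnorm_lt // -!(big_mkord xpredT (fun k => c k *: u k)).
  rewrite [X in X - _](big_cat_nat (n := n)) //= addrAC subrr add0r norm2_sum_onb.
  have := hN n Nn; rewrite /series /= distrC => h.
  apply: le_lt_trans h; apply: le_trans (ler_norm _).
  rewrite lerBrDl; apply: le_trans (les m).
  by rewrite -(big_mkord xpredT (fun k => cnorm2 (c k))) [leRHS](big_cat_nat (n := n)).
exists x; split=> // k.
have h := ip_hcvg (u k) hx; apply: (ccvg_unique h).
have [E1 E2] : ccvg (fun=> c k) (c k) by exact: ccvg_cst.
split; [apply: cvg_trans E1 | apply: cvg_trans E2]; apply: near_eq_cvg;
  by exists k.+1 => // n /= kn; rewrite ip_sum_onb kn.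
Qed.

Hypothesis u_total : forall x : H, (forall k, ip x (u k) = 0) -> x = 0.

Lemma onb_ext x y : (forall k, ip x (u k) = ip y (u k)) -> x = y.
Proof.
move=> h; apply/eqP; rewrite -subr_eq0; apply/eqP/u_total => k.
by rewrite ipBl h subrr.
Qed.

Lemma onb_expand x : hcvg ip (fun n => \sum_(k < n) ip x (u k) *: u k) x.
Proof.
have [|y [hy hyk]] := riesz_fischer (c := fun k => ip x (u k)).
  by exists (norm2 x) => n; exact: bessel.
by rewrite {2}(onb_ext (fun k => esym (hyk k))).
Qed.

Lemma parseval x y : ccvg (fun n => \sum_(k < n) ip x (u k) * (ip y (u k))^*%C) (ip x y).
Proof.
have := ip_hcvg y (onb_expand x); congr ccvg; apply/funext => n.
rewrite ip_suml; apply: eq_bigr => k _; by rewrite ipZl -ipC.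
Qed.

Lemma parseval_norm x : series (fun k => cnorm2 (ip x (u k))) @ \oo --> norm2 x.
Proof.
have [h _] := parseval x x; rewrite -[norm2 x]/(Re (ip x x)).
rewrite (_ : series _ = fun n => Re (\sum_(k < n) ip x (u k) * (ip x (u k))^*%C)) //.
apply/funext => n; rewrite /series /= big_mkord.
by under [in RHS]eq_bigr do rewrite mulcJ; rewrite -rmorph_sum.
Qed.

Lemma onb_norm2_le x (C : R) :
  (forall n, \sum_(k < n) cnorm2 (ip x (u k)) <= C) -> norm2 x <= C.
Proof.
move=> h; apply: (ler_cvg_to (@parseval_norm x) (cvg_cst _)).
by apply: nearW => n; rewrite /series /= big_mkord.
Qed.

Lemma diag_op_exists (a : nat -> R) (C : R) : (forall k, `|a k| <= C) ->
  exists W : H -> H, forall x k, ip (W x) (u k) = ((a k)%:C)%C * ip x (u k).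
Proof.
move=> aC; suff ex (x : H) : exists y, forall k, ip y (u k) = ((a k)%:C)%C * ip x (u k).
  by have [W hW] := choice ex; exists W.
have [|y [_ hy]] := riesz_fischer (c := fun k => ((a k)%:C)%C * ip x (u k)).
  exists (C ^+ 2 * norm2 x) => n.
  apply: le_trans (ler_wpM2l (sqr_ge0 C) (bessel x n)); rewrite mulr_sumr.
  apply: ler_sum => k _; rewrite cnorm2M cnorm2R ler_wpM2r ?cnorm2_ge0 //.
  rewrite -[leLHS]real_normK ?num_real // ler_pXn2r ?nnegrE //.
  exact: le_trans (normr_ge0 _) (aC k).
by exists y.
Qed.

(** * Rank-one perturbations of diagonal operators *)

Section Diagonal.
Variables (a : nat -> R) (W : H -> H).
Hypothesis Wd : forall x k, ip (W x) (u k) = ((a k)%:C)%C * ip x (u k).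

Lemma diag_linear (c : R[i]) x y : W (c *: x + y) = c *: W x + W y.
Proof.
by apply: onb_ext => k; rewrite Wd !(ipDl, ipZl) // !Wd mulrDr mulrCA.
Qed.

Lemma diag_selfadjoint : selfadjoint ip W.
Proof.
move=> x y; have := parseval (W x) y; have := parseval x (W y).
rewrite (_ : (fun n => \sum_(k < n) ip x (u k) * (ip (W y) (u k))^*%C) =
  (fun n => \sum_(k < n) ip (W x) (u k) * (ip y (u k))^*%C)).
  by move=> h /ccvg_unique; apply.
apply/funext => n; apply: eq_bigr => k _.
by rewrite !Wd rmorphM /= oppr0 mulrCA mulrA.
Qed.

Lemma diag_u k : W (u k) = ((a k)%:C)%C *: u k.
Proof.
apply: onb_ext => j; rewrite Wd ipZl // uP.
by have [->//|kj] := eqVneq k j; rewrite !mulr0.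
Qed.

Hypothesis a_gt0 : forall k, 0 < a k.

Lemma aC_neq0 k : ((a k)%:C)%C != 0 :> R[i].
Proof. by rewrite eq_complex /= gt_eqF. Qed.

Lemma diag_ker x : W x = 0 -> x = 0.
Proof.
move=> Wx; apply: u_total => k; have := Wd x k; rewrite Wx ip0l // => /esym/eqP.
by rewrite mulf_eq0 (negbTE (aC_neq0 k)) => /eqP.
Qed.

Lemma diag_nonneg : nonneg_op ip W.
Proof.
move=> x; have [h1 h2] := parseval (W x) x.
have E n : \sum_(k < n) ip (W x) (u k) * (ip x (u k))^*%C =
    ((\sum_(k < n) a k * cnorm2 (ip x (u k)))%:C)%C.
  rewrite rmorph_sum; apply: eq_bigr => k _.
  by rewrite Wd -mulrA mulcJ -rmorphM.
rewrite lecE; apply/andP; split.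
  apply/eqP; rewrite /= -(cvg_lim _ h2) //.
  by rewrite (_ : (fun n => _) = fun=> 0) ?lim_cst //; apply/funext => n; rewrite E.
apply: (ler_cvg_to (cvg_cst _) h1); apply: nearW => n; rewrite E /=.
by apply: sumr_ge0 => k _; rewrite mulr_ge0 ?cnorm2_ge0 // ltW.
Qed.

Lemma onb_neq0 x : x <> 0 -> exists k, ip x (u k) != 0.
Proof.
move=> x0; apply: contra_notP x0 => h; apply: u_total => k.
by apply: contra_notP h => /eqP h; exists k.
Qed.

Lemma diag_eigen_coord x (z : R[i]) k :
  W x = z *: x -> ip x (u k) != 0 -> z = ((a k)%:C)%C.
Proof.
move=> Wx xk; have := Wd x k; rewrite Wx ipZl //.
by move=> /(mulIf xk).
Qed.

Lemma diag_eigenvalue (z : R[i]) :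
  Defs.eigenvalue W z <-> exists k, z = ((a k)%:C)%C.
Proof.
split=> [[x [x0 Wx]]|[k ->]].
  by have [k xk] := onb_neq0 x0; exists k; exact: diag_eigen_coord xk.
exists (u k); split; last exact: diag_u.
by move=> uk0; have := uP k k; rewrite uk0 ip0l // eqxx => /esym/eqP; rewrite oner_eq0.
Qed.

Hypothesis a_inj : injective a.

Lemma diag_eigenvector x k : W x = ((a k)%:C)%C *: x -> x = ip x (u k) *: u k.
Proof.
move=> Wx; apply: onb_ext => j; rewrite ipZl // uP.
have [<-|kj] := eqVneq k j; first by rewrite mulr1.
rewrite mulr0; apply/eqP; apply: contraNT kj => xj; apply/eqP/a_inj.
by have [] := diag_eigen_coord Wx xj.
Qed.

Lemma diag_simple k : simple_eigenvalue W ((a k)%:C)%C.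
Proof.
split; first by apply/diag_eigenvalue; exists k.
move=> x y x0 /diag_eigenvector xE /diag_eigenvector yE.
have xk : ip x (u k) != 0 by apply/eqP => xk; apply: x0; rewrite xE xk scale0r.
by exists (ip y (u k) / ip x (u k)); rewrite {1}yE [X in _ = _ *: X]xE scalerA divfK.
Qed.

Variables (p : H) (W1 : H -> H).
Hypothesis W1E : forall x, W1 x = W x - rank_one ip p x.
Let c k := cnorm2 (ip p (u k)).

Lemma W1_coord x k : ip (W1 x) (u k) =
  ((a k)%:C)%C * ip x (u k) - ip x p * ip p (u k).
Proof. by rewrite W1E ipBl // Wd ipZl. Qed.

Lemma rank_one_eigen_secular x (r : R) : x <> 0 -> W1 x = (r%:C)%C *: x ->
  (forall k, a k != r) -> series (fun k => c k / (a k - r)) @ \oo --> (1 : R).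
Proof.
move=> x0 W1x ar; pose g := ip x p.
have nz k : ((a k - r)%:C)%C != 0 :> R[i] by rewrite eq_complex /= negb_and subr_eq0 ar.
have xk k : ip x (u k) = g * ip p (u k) / ((a k - r)%:C)%C.
  apply: (canRL (mulfK (nz k))); have := W1_coord x k; rewrite W1x ipZl // => E.
  rewrite rmorphB mulrBr [_ * (r%:C)%C]mulrC E mulrC -/g; ring.
have g0 : g != 0.
  apply/eqP => g0; apply: x0; apply: u_total => k.
  by rewrite xk g0 !mul0r.
have := ccvgZ g^-1 (parseval x p); rewrite -/g mulVf // => -[h _].
rewrite (_ : series _ = fun n =>
  complex.Re (g^-1 * (\sum_(k < n) ip x (u k) * (ip p (u k))^*%C))) //.
apply/funext => n; rewrite /series /= big_mkord mulr_sumr.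
transitivity (complex.Re (((\sum_(k < n) c k / (a k - r))%:C)%C : R[i])) => //.
congr complex.Re; rewrite rmorph_sum; apply: eq_bigr => k _.
transitivity (((c k)%:C)%C / ((a k - r)%:C)%C : R[i]); first by rewrite -fmorph_div.
by rewrite xk /c -mulcJ !mulrA mulVf // mul1r mulrAC.
Qed.

Lemma bounded_coords x : bounded_sums (fun k => cnorm2 (ip x (u k))).
Proof. by exists (norm2 x) => n; exact: bessel. Qed.

Lemma secular_rank_one_eigen (r d : R) : 0 < d -> (forall k, d <= `|a k - r|) ->
  series (fun k => c k / (a k - r)) @ \oo --> (1 : R) -> Defs.eigenvalue W1 (r%:C)%C.
Proof.
move=> d0 dr sec.
have ar k : a k - r != 0 by rewrite -normr_gt0; exact: lt_le_trans (dr k).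
have nz k : ((a k - r)%:C)%C != 0 :> R[i] by rewrite eq_complex /= negb_and ar.
have [|x [_ xk]] := riesz_fischer (c := fun k => ip p (u k) / ((a k - r)%:C)%C).
  have [C hC] := bounded_coords p; exists (C / d ^+ 2) => n.
  rewrite ler_pdivlMr ?exprn_gt0 // mulr_suml; apply: le_trans (hC n).
  apply: ler_sum => k _; rewrite cnorm2M -fmorphV cnorm2R -mulrA ler_piMr ?cnorm2_ge0 //.
  have d2 : d ^+ 2 <= (a k - r) ^+ 2.
    by rewrite -[leRHS]real_normK ?num_real // ler_pXn2r ?nnegrE // ltW.
  by rewrite exprVn mulrC ler_pdivrMr ?mul1r // (lt_le_trans _ d2) // exprn_gt0.
have xp : ip x p = 1.
  apply: (ccvg_unique (parseval x p)).
  have E n : \sum_(k < n) ip x (u k) * (ip p (u k))^*%C =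
      ((series (fun k => c k / (a k - r)) n)%:C)%C.
    rewrite /series /= big_mkord rmorph_sum; apply: eq_bigr => k _.
    by rewrite xk mulrAC mulcJ rmorphM fmorphV.
  split; first by under eq_cvg do rewrite E.
  by under eq_cvg do rewrite E; exact: cvg_cst.
exists x; split; first by move=> x0; have /eqP := xp; rewrite x0 ip0l // eq_sym oner_eq0.
apply: onb_ext => k; rewrite W1_coord ipZl // xp mul1r xk.
rewrite -{2}[ip p (u k)](divfK (nz k)) rmorphB; ring.
Qed.

Variable b : nat -> R.
Hypothesis ab : forall k, b k < a k.
Hypothesis ba : forall k, a k.+1 < b k.
Hypothesis a_small : forall e : R, 0 < e -> exists N, a N < e.

Let v k := c k / a k.

Lemma coef_ratioE r k : v k * (a k / (a k - r)) = c k / (a k - r).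
Proof. by rewrite /v mulrA divfK ?gt_eqF. Qed.

Lemma coef_ge0 k : 0 <= c k. Proof. exact: cnorm2_ge0. Qed.

Lemma exists_gap (r : R) : 0 < r -> r < a 0%N -> (forall k, a k != r) ->
  exists k, a k.+1 < r < a k.
Proof.
move=> r0 ra ar; have [N aN] := a_small r0.
elim: N aN => [|N IH] aN; first by have := lt_trans ra aN; rewrite ltxx.
have := ar N; rewrite neq_lt => /orP[/IH//|rN].
by exists N; rewrite aN.
Qed.

Lemma rank_one_spectrum :
  (forall k, c k != 0) -> (forall n, \sum_(k < n) v k <= 1) ->
  (forall j, series (fun k => v k * (a k / (a k - b j))) @ \oo --> (1 : R)) ->
  forall z : R[i], (z <> 0 /\ Defs.eigenvalue W1 z) <-> exists k, z = ((b k)%:C)%C.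
Proof.
move=> c0 v1 sec z; split=> [[z0 [x [x0 W1x]]]|[j ->]].
  have W1sa : ip (W1 x) x = ip x (W1 x).
    rewrite W1E ipBl // ipBr // diag_selfadjoint /rank_one ipZl // ipZr //.
    by rewrite [ip p x]ipC // mulrC.
  have [r zr] : exists r : R, z = (r%:C)%C.
    move: W1sa; rewrite W1x ipZl // ipZr // => /(mulIf _) zz.
    exists (complex.Re z); apply: complex_ext => //=.
    have /zz : ip x x != 0.
      by rewrite ipxx // eq_complex /= gt_eqF // norm2_gt0.
    case: (z) => s t [] /eqP; rewrite -addr_eq0 -mulr2n mulrn_eq0 /=.
    by move/eqP.
  rewrite zr in z0 W1x *.
  have ar k : a k != r.
    apply/eqP => akr; have E j := W1_coord x j.
    have xp : ip x p = 0.
      have := E k; rewrite W1x ipZl // akr => /esym/eqP.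
      rewrite -subr_eq0 addrAC subrr sub0r oppr_eq0 mulf_eq0 => /orP[/eqP//|/eqP h].
      by have := c0 k; rewrite /c h cnorm2_0 eqxx.
    have Wx : W x = ((a k)%:C)%C *: x.
      by rewrite akr -W1x W1E /rank_one xp scale0r subr0.
    have xE := diag_eigenvector Wx; apply: x0; move: xp; rewrite xE ipZl // => /eqP.
    rewrite mulf_eq0 => /orP[/eqP->|/eqP h]; first by rewrite scale0r.
    by have := c0 k; rewrite /c -cnorm2J -ipC // h cnorm2_0 eqxx.
  have sr := rank_one_eigen_secular x0 W1x ar.
  have r0 : r != 0 by apply/eqP => r0; apply: z0; rewrite r0.
  have [rneg|rpos] := ltP r 0.
    exfalso.
    have ark k : 0 < a k - r by rewrite subr_gt0 (lt_trans rneg).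
    have d k : 0 <= v k - c k / (a k - r).
      rewrite subr_ge0 /v ler_wpM2l ?coef_ge0 // lef_pV2 ?posrE // lerDl.
      by rewrite oppr_ge0 ltW.
    have d0 : 0 < v 0 - c 0 / (a 0%N - r).
      have c00 : 0 < c 0 by rewrite lt_neqAle coef_ge0 eq_sym c0.
      rewrite subr_gt0 /v ltr_pM2l //.
      by rewrite ltf_pV2 ?posrE // ltrDl oppr_gt0.
    have : 1 <= 1 - (v 0 - c 0 / (a 0%N - r)).
      apply: (ler_cvg_to sr (cvg_cst _)); exists 1%N => // n /= n1.
      apply: le_trans (_ : \sum_(k < n) v k - (v 0 - c 0 / (a 0%N - r)) <= _); last first.
        by rewrite lerD2r v1.
      rewrite lerBrDr -lerBrDl /series /= big_mkord -sumrB.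
      apply: le_trans (sum_ord_mono (u := fun k => v k - c k / (a k - r)) d n1).
      by rewrite big_ord_recl big_ord0 addr0.
    by move: d0; set t := v 0 - _; lra.
  have {r0}rpos : 0 < r by rewrite lt_neqAle eq_sym r0.
  have [ra|ra] := leP (a 0%N) r.
    exfalso.
    have : (1 : R) <= 0.
      apply: (ler_cvg_to sr (cvg_cst _)); apply: nearW => n.
      rewrite /series /= big_mkord; apply: sumr_le0 => k _.
      rewrite mulr_ge0_le0 ?coef_ge0 // invr_le0 subr_le0.
      by apply: le_trans ra; exact: (a_anti ab ba).
    by rewrite leNgt ltr01.
  have [k /andP[kr rk]] := exists_gap rpos ra ar.
  exists k; congr ((_%:C)%C); apply/eqP; rewrite -subr_eq0; apply/negPn/negP => rb.
  pose e i := c i / ((a i - r) * (a i - b k)).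
  have e0 i : 0 < e i.
    have ci : 0 < c i by rewrite lt_neqAle coef_ge0 eq_sym c0.
    rewrite divr_gt0 //.
    have [ik|ki] := leqP i k.
      rewrite mulr_gt0 ?subr_gt0 ?(b_lt_a ab ba) //.
      by apply: lt_le_trans rk _; exact: (a_anti ab ba).
    rewrite nmulr_rgt0 ?subr_lt0 ?(a_lt_b ab ba) //.
    by apply: le_lt_trans kr; exact: (a_anti ab ba).
  have bi i : a i - b k != 0 by rewrite subr_eq0 a_neq_b.
  have ai i : a i - r != 0 by rewrite subr_eq0 ar.
  have eE : series e = fun n => (r - b k)^-1 * (series (fun i => c i / (a i - r)) n
      - series (fun i => v i * (a i / (a i - b k))) n).
    apply/funext => n; rewrite /series /= -sumrB mulr_sumr; apply: eq_bigr => i _.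
    by rewrite coef_ratioE /e; have := bi i; have := ai i => ? ?; field; apply/and3P.
  have ec : series e @ \oo --> (0 : R).
    rewrite eE -(mulr0 (r - b k)^-1) -(subrr 1); apply: cvgMl_tmp.
    by apply: cvgB => //; exact: sec.
  have : e 0 <= 0.
    apply: (ler_cvg_to (cvg_cst _) ec); exists 1%N => // n /= n1.
    rewrite /series /= big_mkord.
    apply: le_trans (sum_ord_mono (fun i => ltW (e0 i)) n1).
    by rewrite big_ord_recl big_ord0 addr0.
  by rewrite leNgt e0.
split; first by apply/eqP; rewrite eq_complex /= gt_eqF // (lt_trans _ (ba j)).
apply: (@secular_rank_one_eigen _ (Num.min (a j - b j) (b j - a j.+1))).
- by rewrite lt_min !subr_gt0 ab ba.
- move=> k; have [kj|jk] := leqP k j.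
    rewrite ger0_norm ?subr_ge0 ?(ltW (b_lt_a ab ba _)) // ge_min lerD2r.
    by rewrite (a_anti ab ba).
  rewrite distrC ger0_norm ?subr_ge0 ?(ltW (a_lt_b ab ba _)) // ge_min orbC lerD2l lerN2.
  by rewrite (a_anti ab ba).
- by have := sec j; under eq_fun do rewrite coef_ratioE.
Qed.

Lemma rank_one_spectrum_secular :
  (forall z : R[i], (z <> 0 /\ Defs.eigenvalue W1 z) <-> exists k, z = ((b k)%:C)%C) ->
  (forall n, \sum_(k < n) v k <= 1) /\
  (forall j, series (fun k => v k * (a k / (a k - b j))) @ \oo --> (1 : R)).
Proof.
move=> spec; split.
  have [C hC] := bounded_coords p.
  apply: (secular_bound a_gt0 coef_ge0 hC) => t t0 ht.
  have : Defs.eigenvalue W1 ((- t)%:C)%C.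
    apply: (@secular_rank_one_eigen _ t) => //.
      by move=> k; rewrite opprK ger0_norm ?lerDr ?ltW // addr_gt0.
    by under eq_fun do rewrite opprK.
  move=> h; have [|k [] tb] := (spec ((- t)%:C)%C).1.
    by split => //; apply/eqP; rewrite eq_complex /= oppr_eq0 gt_eqF.
  by have := b_gt0 ba a_gt0 k; rewrite -tb oppr_gt0 ltNge ltW.
move=> j; have [|bj0 [x [x0 W1x]]] := (spec ((b j)%:C)%C).2; first by exists j.
under eq_fun do rewrite coef_ratioE; apply: rank_one_eigen_secular x0 W1x _.
by move=> k; exact: a_neq_b.
Qed.

Section Compactness.
Hypothesis a_anti : forall i j : nat, (i <= j)%N -> a j <= a i.

Lemma weak_sequential_compactness (x : nat -> H) : (forall n, norm2 (x n) <= 1) ->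
  exists phi : nat -> nat, (forall n, (phi n < phi n.+1)%N) /\
  exists l, norm2 l <= 1 /\
    forall k, (fun n => cnorm2 (ip (x (phi n) - l) (u k))) @ \oo --> (0 : R).
Proof.
move=> x1.
pose f n (i : nat) : R := let z := ip (x n) (u i./2) in
  if odd i then complex.Im z else complex.Re z.
have f1 n i : -1 <= f n i <= 1.
  rewrite -ler_norml; apply: le_trans (_ : Num.sqrt 1 <= _); last by rewrite sqrtr1.
  apply: le_trans (_ : Num.sqrt (cnorm2 (ip (x n) (u i./2))) <= _).
    by rewrite /f; case: odd; [exact: Im_le_cnorm2|exact: Re_le_cnorm2].
  rewrite ler_wsqrtr //; apply: le_trans (x1 n); apply: le_trans (bessel (x n) i./2.+1).
  by rewrite big_ord_recr /= lerDr sumr_ge0 // => j _; exact: cnorm2_ge0.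
have [phi phi_lt [g hg]] := diagonal_subsequence f1.
pose y k : R[i] := Complex (g k.*2) (g k.*2.+1).
have xy k : ccvg (fun n => ip (x (phi n)) (u k)) (y k).
  split => /=.
    by have := hg k.*2; under eq_fun do rewrite /f odd_double doubleK.
  by have := hg k.*2.+1; under eq_fun do rewrite /f /= odd_double /= uphalf_double.
have y1 n : \sum_(k < n) cnorm2 (y k) <= 1.
  have L := cvg_big_sum (r := index_enum 'I_n) (fun k : 'I_n => cnorm2_cvg (xy k)).
  apply: (ler_cvg_to L (cvg_cst _)); apply: nearW => m.
  exact: le_trans (bessel _ _) (x1 _).
have [|l [_ lk]] := riesz_fischer (c := y); first by exists 1.
exists phi; split => //; exists l; split.
  by apply: onb_norm2_le => n; under eq_bigr do rewrite lk.
move=> k; rewrite -(cnorm2_0 R) -(subrr (y k)).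
under eq_fun do rewrite ipBl // lk.
by apply/cnorm2_cvg/ccvgD; [exact: xy|exact: ccvg_cst].
Qed.

Lemma diag_norm2_le K x : norm2 (W x) <=
  a 0 ^+ 2 * (\sum_(k < K) cnorm2 (ip x (u k))) + a K ^+ 2 * norm2 x.
Proof.
have a2 i j : (i <= j)%N -> a j ^+ 2 <= a i ^+ 2.
  by move=> ij; rewrite ler_pXn2r ?nnegrE ?(ltW (a_gt0 _)) // a_anti.
apply: onb_norm2_le => m; pose g k := a k ^+ 2 * cnorm2 (ip x (u k)).
have g0 k : 0 <= g k by rewrite mulr_ge0 ?cnorm2_ge0 // exprn_ge0 // ltW.
rewrite (eq_bigr (fun k : 'I_m => g k)); last first.
  by move=> k _; rewrite Wd cnorm2M cnorm2R.
apply: le_trans (sum_ord_mono g0 (leq_maxl m K)) _.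
rewrite -(big_mkord xpredT) (big_cat_nat (n := K)) ?leq_maxr //= big_mkord.
apply: lerD.
  by rewrite mulr_sumr; apply: ler_sum => k _; rewrite ler_wpM2r ?cnorm2_ge0 // a2.
apply: le_trans (ler_wpM2l (exprn_ge0 _ (ltW (a_gt0 K))) (bessel x (maxn m K))).
rewrite -(big_mkord xpredT (fun k => cnorm2 (ip x (u k)))).
rewrite [in leRHS](big_cat_nat (n := K)) ?leq_maxr //= mulrDr ler_wpDl //.
  by rewrite mulr_ge0 ?exprn_ge0 ?(ltW (a_gt0 _)) // sumr_ge0 // => k _; exact: cnorm2_ge0.
rewrite mulr_sumr big_nat_cond [leRHS]big_nat_cond.
apply: ler_sum => k; rewrite andbT => /andP[Kk _].
by rewrite ler_wpM2r ?cnorm2_ge0 // a2.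
Qed.

Lemma diag_weak_cvg (x : nat -> H) (C : R) : (forall n, norm2 (x n) <= C) ->
  (forall k, (fun n => cnorm2 (ip (x n) (u k))) @ \oo --> (0 : R)) ->
  (fun n => norm2 (W (x n))) @ \oo --> (0 : R).
Proof.
move=> xC xk; apply/cvg_natP => e e0.
have C0 : 0 <= C := le_trans (norm2_ge0 _) (xC 0).
have C1 : 0 < C + 1 by rewrite ltr_wpDl.
have d0 : 0 < e / 2 / (C + 1) by rewrite !divr_gt0.
have [K aK] : exists K, a K ^+ 2 < e / 2 / (C + 1).
  have [|K hK] := a_small (e := Num.sqrt (e / 2 / (C + 1))); first by rewrite sqrtr_gt0.
  exists K; rewrite -(sqr_sqrtr (ltW d0)) ltr_pXn2r // nnegrE ?sqrtr_ge0 //.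
  exact: ltW.
have L := cvg_big_sum (r := index_enum 'I_K) (fun k : 'I_K => xk k).
rewrite big1 // in L.
have L2 : (fun n => a 0%N ^+ 2 * \sum_(k < K) cnorm2 (ip (x n) (u k))) @ \oo --> (0 : R).
  by rewrite -[X in _ --> X](mulr0 (a 0%N ^+ 2)); apply: cvgMl_tmp; exact: L.
have [N hN] := (cvg_natP _ _).1 L2 (e / 2) ltac:(lra).
exists N => n Nn; rewrite subr0 ger0_norm ?norm2_ge0 //.
apply: le_lt_trans (diag_norm2_le K (x n)) _.
rewrite (splitr e) ltr_leD //.
  by have := hN n Nn; rewrite subr0; apply: le_lt_trans; exact: ler_norm.
apply: le_trans (_ : e / 2 / (C + 1) * C <= _).
  by rewrite ler_pM ?norm2_ge0 ?exprn_ge0 ?(ltW (a_gt0 _)) // ltW.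
by rewrite mulrAC ler_pdivrMr // ler_pM2l ?divr_gt0 // lerDl.
Qed.

Lemma ip_weak_cvg (x : nat -> H) (C : R) q : (forall n, norm2 (x n) <= C) ->
  (forall k, (fun n => cnorm2 (ip (x n) (u k))) @ \oo --> (0 : R)) ->
  (fun n => cnorm2 (ip (x n) q)) @ \oo --> (0 : R).
Proof.
move=> xC xk; apply/cvg_natP => e e0.
have C0 : 0 <= C := le_trans (norm2_ge0 _) (xC 0).
have C1 : 0 < C + 1 by rewrite ltr_wpDl.
have d0 : 0 < e / 4 / (C + 1) by rewrite !divr_gt0.
have /hcvgP hq := onb_expand q.
have [K hK] := (cvg_natP _ _).1 hq _ d0.
have {hK} := hK K (leqnn _); set S := \sum_(k < K) _ => hK.
have xS : ccvg (fun n => ip S (x n)) 0.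
  rewrite (_ : (fun n => _) = fun n => \sum_(k < K) ip q (u k) * (ip (x n) (u k))^*%C); last first.
    apply/funext => n; rewrite /S ip_suml; apply: eq_bigr => k _.
    by rewrite ipZl -ipC.
  elim: (K) => [|k IH].
    rewrite (_ : (fun n => _) = fun=> 0); first exact: ccvg_cst.
    by apply/funext => n; rewrite big_ord0.
  rewrite (_ : (fun n => _) = fun n => \sum_(k < k) ip q (u k) * (ip (x n) (u k))^*%C +
    ip q (u k) * (ip (x n) (u k))^*%C); last first.
    by apply/funext => n; rewrite big_ord_recr.
  rewrite -[X in ccvg _ X](addr0 0); apply: (ccvgD IH).
  rewrite -[X in ccvg _ X](mulr0 (ip q (u k))).
  apply: ccvgZ; rewrite -[X in ccvg _ X](rmorph0 (@conjc R)); apply: ccvgJ.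
  by apply: ccvg_of_cnorm2; under eq_fun do rewrite subr0; exact: xk.
have := cnorm2_cvg xS; rewrite cnorm2_0 => L.
have [N hN] := (cvg_natP _ _).1 L (e / 4) ltac:(lra).
exists N => n Nn; rewrite subr0 ger0_norm ?cnorm2_ge0 //.
have -> : ip (x n) q = ip (x n) S - ip (x n) (S - q) by rewrite ipBr // subKr.
have := cnorm2D (ip (x n) S) (- ip (x n) (S - q)); rewrite cnorm2N.
have := cauchy_schwarz (x n) (S - q); have := hN n Nn; rewrite subr0 ipC cnorm2J.
rewrite subr0 ger0_norm ?norm2_ge0 // in hK; rewrite ger0_norm ?cnorm2_ge0 //.
have : norm2 (x n) * norm2 (S - q) <= (C + 1) * (e / 4 / (C + 1)).
  by rewrite ler_pM ?norm2_ge0 ?(ltW hK) // (le_trans (xC n)) // lerDl.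
rewrite [(C + 1) * _]mulrC divfK ?gt_eqF //; lra.
Qed.

Lemma bounded_weak_limit (x : nat -> H) : (forall n, hnorm ip (x n) <= 1) ->
  exists phi : nat -> nat, (forall n, (phi n < phi n.+1)%N) /\
  exists l, (forall n, norm2 (x (phi n) - l) <= 4) /\
    forall k, (fun n => cnorm2 (ip (x (phi n) - l) (u k))) @ \oo --> (0 : R).
Proof.
move=> x1; have x2 n : norm2 (x n) <= 1 by rewrite -(expr1n R 2) -hnorm_le.
have [phi [phi_lt [l [l1 hl]]]] := weak_sequential_compactness x2.
exists phi; split => //; exists l; split => // n.
by apply: le_trans (norm2_sub_le _ _) _; have := x2 (phi n); lra.
Qed.

Lemma diag_sub x y : W (x - y) = W x - W y.
Proof. by apply: onb_ext => k; rewrite Wd !ipBl // !Wd mulrBr. Qed.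

Lemma diag_compact : compact_op ip W.
Proof.
split; first exact: diag_linear.
move=> x /bounded_weak_limit [phi [phi_lt [l [l1 hl]]]].
exists phi; split => //; exists (W l); apply/hcvgP.
by under eq_fun do rewrite -diag_sub; exact: diag_weak_cvg l1 hl.
Qed.

Lemma rank_one_compact : compact_op ip W1.
Proof.
split=> [s x y|x].
  rewrite !W1E diag_linear /rank_one ip_lin // scalerDl scalerBr scalerA.
  by rewrite opprD addrACA.
move=> /bounded_weak_limit [phi [phi_lt [l [l1 hl]]]].
exists phi; split => //; exists (W1 l); apply/hcvgP.
pose d n := x (phi n) - l.
have E n : W1 (x (phi n)) - W1 l = W (d n) - ip (d n) p *: p.
  by rewrite !W1E /d diag_sub /rank_one ipBl // scalerBl !opprD !opprK addrACA.
under eq_fun do rewrite E.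
apply: (norm2_squeeze (g := fun n => 2 * (norm2 (W (d n)) + cnorm2 (ip (d n) p) * norm2 p))).
  by move=> n; rewrite norm2_ge0 //= -norm2Z norm2_sub_le.
rewrite -(mulr0 2); apply: cvgMl_tmp; rewrite -(addr0 0) -[X in _ + X](mul0r (norm2 p)).
apply: cvgD; first exact: diag_weak_cvg l1 hl.
by apply: cvgMr_tmp; exact: ip_weak_cvg l1 hl.
Qed.

End Compactness.

End Diagonal.

End Orthonormal.

Lemma rephase (u : nat -> H) (p : H) (c : nat -> R[i]) :
  complete_orthonormal u -> (forall k, cnorm2 (ip p (u k)) = cnorm2 (c k)) ->
  (forall k, c k != 0) ->
  exists s : nat -> R[i], complete_orthonormal (fun k => s k *: u k) /\
    forall k, ip p (s k *: u k) = c k.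
Proof.
move=> [uP ut] hc c0.
have p0 k : ip p (u k) != 0.
  apply/eqP => h; have := c0 k; have := hc k; rewrite h cnorm2_0 => /esym/cnorm2_eq0 ->.
  by rewrite eqxx.
pose s k := (c k / ip p (u k))^*%C.
have s1 k : cnorm2 (s k) = 1.
  have : cnorm2 (s k) * cnorm2 (ip p (u k)) = cnorm2 (ip p (u k)).
    by rewrite cnorm2J -cnorm2M divfK.
  by move=> h; apply: (mulIf (lt0r_neq0 (cnorm2_gt0 (p0 k)))); rewrite h mul1r.
exists s; split; last by move=> k; rewrite ipZr conjcK divfK.
split=> [j k|x hx].
  rewrite ipZl ipZr uP; have [->|jk] := eqVneq j k; last by rewrite !mulr0.
  by rewrite mulr1 mulcJ s1.
apply: ut => k; have := hx k; rewrite ipZr => /eqP; rewrite mulf_eq0 => /orP[|/eqP//].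
by move=> /eqP h; have := s1 k; rewrite -cnorm2J h cnorm2_0 => /esym/eqP; rewrite oner_eq0.
Qed.

(** * Eigenbases of compact operators *)

Section Spectral.
Hypothesis cplt : hcomplete ip.
Variables (W : H -> H) (a : nat -> R).
Hypothesis W_sa : selfadjoint ip W.
Hypothesis W_ge0 : nonneg_op ip W.
Hypothesis W_ker : forall x, W x = 0 -> x = 0.
Hypothesis W_cpt : compact_op ip W.
Hypothesis a_gt0 : forall k, 0 < a k.
Hypothesis a_inj : injective a.
Hypothesis W_eig : forall z : R[i], Defs.eigenvalue W z <-> exists k, z = ((a k)%:C)%C.
Hypothesis W_simple : forall k, simple_eigenvalue W ((a k)%:C)%C.

Lemma compact_opD x y : W (x + y) = W x + W y.
Proof. by rewrite -[x]scale1r W_cpt.1 !scale1r. Qed.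

Lemma compact_op0 : W 0 = 0.
Proof. by apply: (addrI (W 0)); rewrite -compact_opD !addr0. Qed.

Lemma compact_opZ (c : R[i]) x : W (c *: x) = c *: W x.
Proof. by rewrite -[c *: x]addr0 W_cpt.1 compact_op0 addr0. Qed.

Lemma compact_opB x y : W (x - y) = W x - W y.
Proof. by rewrite compact_opD -scaleN1r compact_opZ scaleN1r. Qed.

Lemma normalize x : x <> 0 -> norm2 (((Num.sqrt (norm2 x))^-1%:C)%C *: x) = 1.
Proof.
move=> /norm2_gt0 x0; rewrite norm2Z cnorm2R exprVn sqr_sqrtr ?norm2_ge0 //.
by rewrite mulVf // gt_eqF.
Qed.

Lemma norm2_op_normalize x : x <> 0 ->
  norm2 (W (((Num.sqrt (norm2 x))^-1%:C)%C *: x)) = norm2 (W x) / norm2 x.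
Proof.
move=> /norm2_gt0 x0; rewrite compact_opZ norm2Z cnorm2R exprVn sqr_sqrtr ?norm2_ge0 //.
exact: mulrC.
Qed.

Lemma strictly_increasing_ge (phi : nat -> nat) :
  (forall n, (phi n < phi n.+1)%N) -> forall n, (n <= phi n)%N.
Proof. by move=> h; elim=> // n IH; apply: leq_ltn_trans IH (h n). Qed.

Lemma compact_bounded : exists2 C, 0 <= C & forall x, norm2 (W x) <= C * norm2 x.
Proof.
apply: contrapT => nb.
have ex (n : nat) : exists y, norm2 y = 1 /\ n%:R <= norm2 (W y).
  apply: contrapT => ny; apply: nb; exists n%:R => // x.
  have [->|/eqP x0] := eqVneq x 0; first by rewrite compact_op0 !norm2_0 mulr0.
  rewrite leNgt; apply/negP => h; apply: ny.
  exists (((Num.sqrt (norm2 x))^-1%:C)%C *: x); split; first exact: normalize.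
  by rewrite norm2_op_normalize // ler_pdivlMr ?norm2_gt0 // ltW.
have [y hy] := choice ex.
have [|phi [phi_lt [l hl]]] := W_cpt.2 y.
  by move=> n; rewrite hnorm_le // expr1n (hy n).1.
have L := norm2_hcvg hl.
have [N hN] := (cvg_natP _ _).1 L 1 ltr01.
pose M := maxn N (Num.truncn (norm2 l + 1)).+1.
have h1 := hN M (leq_maxl _ _).
have h2 : norm2 l + 1 < norm2 (W (y (phi M))).
  apply: lt_le_trans (hy (phi M)).2.
  apply: lt_le_trans (truncnS_gt (norm2 l + 1)) _.
  by rewrite ler_nat (leq_trans (leq_maxr N _)) // strictly_increasing_ge.
by move: h1; rewrite ltr_norml; lra.
Qed.

Lemma op_hcvg x l : hcvg ip x l -> hcvg ip (fun n => W (x n)) (W l).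
Proof.
have [C C0 hC] := compact_bounded; move=> /hcvgP h; apply/hcvgP.
apply: (norm2_squeeze (g := fun n => C * norm2 (x n - l))).
  by move=> n; rewrite norm2_ge0 -compact_opB hC.
by rewrite -[X in _ --> X](mulr0 C); apply: cvgMl_tmp.
Qed.

Section Complement.
Variable e : nat -> H.
Hypothesis e_eig : forall k, W (e k) = ((a k)%:C)%C *: e k.
Hypothesis e_norm : forall k, ip (e k) (e k) = 1.
Let M x := forall k, ip x (e k) = 0.

Lemma complement_stable x : M x -> M (W x).
Proof. by move=> Mx k; rewrite W_sa e_eig ipZr Mx mulr0. Qed.

Lemma complementD x y : M x -> M y -> M (x + y).
Proof. by move=> Mx My k; rewrite ipDl Mx My addr0. Qed.

Lemma complementZ (c : R[i]) x : M x -> M (c *: x).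
Proof. by move=> Mx k; rewrite ipZl Mx mulr0. Qed.

(* The maximum of [norm2 (W y)] on the unit sphere of the complement is
   attained, at an eigenvector of [W \o W]. *)
Lemma complement_max x : M x -> x <> 0 ->
  exists z m, [/\ M z, norm2 z = 1, 0 < m & W (W z) = ((m ^+ 2)%:C)%C *: z].
Proof.
move=> Mx x0; have [C C0 hC] := compact_bounded.
pose S := [set r : R | exists y, [/\ M y, norm2 y = 1 & r = norm2 (W y)]].
have Sub : ubound S C.
  by move=> _ [y [_ y1 ->]]; apply: le_trans (hC y) _; rewrite y1 mulr1.
have Sne : S !=set0.
  exists (norm2 (W (((Num.sqrt (norm2 x))^-1%:C)%C *: x))).
  by exists (((Num.sqrt (norm2 x))^-1%:C)%C *: x); split => //;
    [exact: complementZ | exact: normalize].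
have hS : has_sup S by split => //; exists C.
pose s := sup S.
have leS y : M y -> norm2 (W y) <= s * norm2 y.
  move=> My; have [->|/eqP y0] := eqVneq y 0; first by rewrite compact_op0 norm2_0 mulr0.
  rewrite -ler_pdivrMr ?norm2_gt0 // -norm2_op_normalize //.
  apply: (ub_le_sup hS.2); exists (((Num.sqrt (norm2 y))^-1%:C)%C *: y).
  by split => //; [exact: complementZ | exact: normalize].
have s0 : 0 < s.
  have Wx0 : 0 < norm2 (W x) by apply: norm2_gt0 => /W_ker.
  by have := lt_le_trans Wx0 (leS x Mx); rewrite pmulr_lgt0 // norm2_gt0.
have ex n : exists y, [/\ M y, norm2 y = 1 & s - harmonic n < norm2 (W y)].
  have [_ [y [My y1 ->]] hy] := sup_adherent (harmonic_gt0 (R := R) n) hS.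
  by exists y.
have [y hy] := choice ex.
have res n : norm2 (W (W (y n)) - (s%:C)%C *: y n) <= s * harmonic n.
  have [My y1 hyn] := hy n; rewrite norm2B norm2Z cnorm2R y1 mulr1.
  have -> : complex.Re (ip (W (W (y n))) ((s%:C)%C *: y n)) = s * norm2 (W (y n)).
    by rewrite ipZr W_sa cReM /= oppr0 mul0r subr0.
  have := leS _ (complement_stable My); move: hyn.
  by set A := norm2 (W (y n)); set B := norm2 _; set h := harmonic n; nra.
have [|phi [phi_lt [l hl]]] := W_cpt.2 y.
  by move=> n; rewrite hnorm_le // expr1n; have [_ ->] := hy n.
pose z := ((s^-1)%:C)%C *: W l.
have yz : hcvg ip (fun n => y (phi n)) z.
  apply/hcvgP.
  apply: (norm2_squeeze (g := fun n => s^-1 ^+ 2 *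
    (2 * (norm2 (W (W (y (phi n))) - W l) + s * harmonic n)))).
    move=> n; rewrite norm2_ge0 /=.
    have -> : y (phi n) - z = ((s^-1)%:C)%C *: ((W (W (y (phi n))) - W l) -
        (W (W (y (phi n))) - (s%:C)%C *: y (phi n))).
      rewrite opprB [X in _ *: X]addrC addrA subrK scalerBr scalerA -rmorphM mulVf ?gt_eqF //.
      by rewrite scale1r.
    rewrite norm2Z cnorm2R ler_wpM2l ?sqr_ge0 //.
    apply: le_trans (norm2_sub_le _ _) _; rewrite ler_pM2l // lerD2l.
    apply: le_trans (res _) _; rewrite ler_pM2l // lef_pV2 ?posrE //.
    by rewrite ler_nat ltnS strictly_increasing_ge.
  rewrite -(mulr0 (s^-1 ^+ 2)); apply: cvgMl_tmp.
  rewrite -[X in _ --> X](mulr0 2); apply: cvgMl_tmp.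
  rewrite -[X in _ --> X](addr0 0); apply: cvgD; first exact/hcvgP/op_hcvg.
  by rewrite -[X in _ --> X](mulr0 s); apply: cvgMl_tmp; exact: cvg_harmonic.
have lE : l = W z by apply: hcvg_unique hl _; exact: op_hcvg.
exists z, (Num.sqrt s); split.
- move=> k; apply: (ccvg_unique (ip_hcvg (e k) yz)).
  rewrite (_ : (fun n => _) = fun=> 0); first exact: ccvg_cst.
  by apply/funext => n; have [My _ _] := hy (phi n).
- have L := norm2_hcvg yz; rewrite -(cvg_lim _ L) //.
  rewrite (_ : (fun n => _) = fun=> 1) ?lim_cst //.
  by apply/funext => n; have [_ ->] := hy (phi n).
- by rewrite sqrtr_gt0.
- rewrite sqr_sqrtr ?ltW // -lE /z scalerA -rmorphM mulfV ?gt_eqF //.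
  by rewrite scale1r.
Qed.

Lemma eigenvectors_total x : M x -> x = 0.
Proof.
move=> Mx; apply: contrapT => x0.
have [z [m [Mz z1 m0 WWz]]] := complement_max Mx x0.
pose g := W z + (m%:C)%C *: z.
have Wg : W g = (m%:C)%C *: g.
  by rewrite /g compact_opD compact_opZ WWz expr2 rmorphM -scalerA addrC -scalerDr.
have Mg : M g by apply: complementD; [exact: complement_stable|exact: complementZ].
have [g0|/eqP g0] := eqVneq g 0.
  have Wz : W z = - ((m%:C)%C *: z) by apply/eqP; rewrite -addr_eq0; apply/eqP.
  have := W_ge0 z; rewrite Wz ipNl ipZl ipxx z1 mulr1 lecE /= => /andP[_].
  by rewrite oppr_ge0 leNgt m0.
have [k [mk]] := (W_eig (m%:C)%C).1 (ex_intro _ g (conj g0 Wg)).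
have ek0 : e k <> 0 by move=> h; have /eqP := e_norm k; rewrite h ip0l eq_sym oner_eq0.
have [|c gc] := (W_simple k).2 (e k) g ek0 (e_eig k); first by rewrite -mk.
apply: g0; have := Mg k; rewrite gc ipZl e_norm mulr1 => ->.
by rewrite scale0r.
Qed.

End Complement.

Lemma eigenbasis_exists : exists u : nat -> H,
  complete_orthonormal u /\ forall k, W (u k) = ((a k)%:C)%C *: u k.
Proof.
have ex k : exists x, ip x x = 1 /\ W x = ((a k)%:C)%C *: x.
  have [[x [x0 Wx]] _] := W_simple k.
  exists (((Num.sqrt (norm2 x))^-1%:C)%C *: x).
  by rewrite ipxx normalize // compact_opZ Wx !scalerA mulrC.
have [u hu] := choice ex; exists u; split; last by move=> k; case: (hu k).
have e_eig k := (hu k).2; have e_norm k := (hu k).1.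
split; last exact: eigenvectors_total e_eig e_norm.
move=> j k; have [->|jk] := eqVneq j k; first exact: e_norm.
have := W_sa (u j) (u k); rewrite !e_eig ipZl ipZr => /eqP.
rewrite -subr_eq0 -mulrBl mulf_eq0 => /orP[|/eqP//].
by rewrite /= oppr0 -[_ - _]rmorphB eq_complex /= eqxx andbT subr_eq0 => /eqP /a_inj /eqP;
  rewrite (negbTE jk).
Qed.

End Spectral.

End Inner.

(** * Unitary equivalence *)

Section TwoSpaces.
Variables (R : realType) (H H' : lmodType R[i]).
Variables (ip : H -> H -> R[i]) (ip' : H' -> H' -> R[i]).
Hypothesis ipP : inner_product_axioms ip.
Hypothesis ipP' : inner_product_axioms ip'.
Hypothesis cplt' : hcomplete ip'.

Lemma coordinate_transfer (u : nat -> H) (u' : nat -> H') :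
  complete_orthonormal ip u -> complete_orthonormal ip' u' ->
  exists U : H -> H', forall x k, ip' (U x) (u' k) = ip x (u k).
Proof.
move=> [uP _] [uP' _].
suff ex (x : H) : exists y, forall k, ip' y (u' k) = ip x (u k).
  by have [U hU] := choice ex; exists U.
have [y [_ hy]] := riesz_fischer ipP' uP' cplt' (bounded_coords ipP uP x).
by exists y.
Qed.

End TwoSpaces.

Section Equivalence.
Variables (R : realType) (H H' : lmodType R[i]).
Variables (ip : H -> H -> R[i]) (ip' : H' -> H' -> R[i]).
Hypothesis ipP : inner_product_axioms ip.
Hypothesis ipP' : inner_product_axioms ip'.
Hypothesis cplt : hcomplete ip.
Hypothesis cplt' : hcomplete ip'.
Variables (u : nat -> H) (u' : nat -> H').
Hypothesis uP : complete_orthonormal ip u.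
Hypothesis uP' : complete_orthonormal ip' u'.
Variables (a : nat -> R) (W W1 : H -> H) (p : H) (W' W1' : H' -> H') (p' : H').
Hypothesis Wd : forall x k, ip (W x) (u k) = ((a k)%:C)%C * ip x (u k).
Hypothesis Wd' : forall x k, ip' (W' x) (u' k) = ((a k)%:C)%C * ip' x (u' k).
Hypothesis W1E : forall x, W1 x = W x - rank_one ip p x.
Hypothesis W1E' : forall x, W1' x = W' x - rank_one ip' p' x.
Hypothesis pp' : forall k, ip p (u k) = ip' p' (u' k).

Lemma coordinate_equivalence : unitarily_equivalent ip ip' W W1 p W' W1' p'.
Proof.
have [U hU] := coordinate_transfer ipP ipP' cplt' uP uP'.
have [Us hUs] := coordinate_transfer ipP' ipP cplt uP' uP.
have [u1 u2] := uP; have [u1' u2'] := uP'.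
have ext := onb_ext ipP u2; have ext' := onb_ext ipP' u2'.
have adj x y : ip' (U x) y = ip x (Us y).
  have h := parseval ipP u1 cplt u2 x (Us y).
  have h' := parseval ipP' u1' cplt' u2' (U x) y.
  apply: (ccvg_unique h').
  rewrite (_ : (fun n => _) = (fun n =>
    \sum_(k < n) ip x (u k) * (ip (Us y) (u k))^*%C)) //.
  by apply/funext => n; apply: eq_bigr => k _; rewrite hU hUs.
have UK : cancel Us U by move=> y; apply: ext' => k; rewrite hU hUs.
have pU : p' = U p by apply: ext' => k; rewrite hU pp'.
exists U, Us; split => //.
- by move=> c x y; apply: ext' => k; rewrite ip_lin // !hU ip_lin.
- by split => // x; apply: ext => k; rewrite hUs hU.
- split => // y; apply: ext' => k; rewrite hU.
    by rewrite Wd' Wd hUs.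
  rewrite W1E' W1E (ipBl ipP') (ipBl ipP) Wd' Wd hUs /rank_one (ipZl ipP') (ipZl ipP) pp'.
  by rewrite [ip (Us y) p](ipC ipP) -adj -pU -(ipC ipP').
Qed.

End Equivalence.

(** * The space of square-summable sequences *)

Section Ell2.
Variable R : realType.
Local Notation Re := complex.Re.
Local Notation Im := complex.Im.

Definition square_summable : {pred (nat -> R[i])} :=
  fun x => `[< bounded_sums (fun k => cnorm2 (x k)) >].

Lemma square_summableP (x : nat -> R[i]) :
  reflect (bounded_sums (fun k => cnorm2 (x k))) (x \in square_summable).
Proof. exact: asboolP. Qed.

Lemma square_summable_submod : submod_closed square_summable.
Proof.
split.
  by apply/square_summableP; exists 0 => n; rewrite big1 // => k _; exact: cnorm2_0.
move=> a x y /square_summableP [C hC] /square_summableP [D hD].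
apply/square_summableP; exists (2 * (cnorm2 a * C + D)) => n.
apply: (@le_trans _ _ (\sum_(k < n) 2 * (cnorm2 a * cnorm2 (x k) + cnorm2 (y k)))).
  apply: ler_sum => k _; rewrite -cnorm2M; exact: cnorm2D.
rewrite -mulr_sumr ler_pM2l // big_split /= -mulr_sumr lerD //.
  by rewrite ler_wpM2l ?cnorm2_ge0 ?hC.
exact: hD.
Qed.

HB.instance Definition _ := GRing.isSubmodClosed.Build R[i] (nat -> R[i])
  square_summable square_summable_submod.

Record ell2 := Ell2 { ell2_val :> nat -> R[i]; _ : ell2_val \in square_summable }.

HB.instance Definition _ := [isSub for ell2_val].
HB.instance Definition _ := [Choice of ell2 by <:].
HB.instance Definition _ := [SubChoice_isSubLmodule of ell2 by <:].

Lemma ell2_bounded (x : ell2) : bounded_sums (fun k => cnorm2 (x k)).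
Proof. by apply/square_summableP; case: x. Qed.

Lemma ell2_subE (x y : ell2) k : (x - y) k = x k - y k.
Proof. by []. Qed.

Lemma ell2_ext (x y : ell2) : (forall k, x k = y k) -> x = y.
Proof. by move=> h; apply/val_inj/funext. Qed.

Lemma dominated_series_cvg (u w : nat -> R) : (forall k, `|u k| <= w k) ->
  bounded_sums w -> cvgn (series u).
Proof.
move=> uw [C hC]; have w0 k : 0 <= w k := le_trans (normr_ge0 _) (uw k).
have [s [ws _ _]] := bounded_sums_cvg w0 hC.
apply: normed_cvg; apply: (series_le_cvg _ w0 uw) => //.
by apply/cvg_ex; exists s.
Qed.

Definition ell2_ip (x y : ell2) : R[i] :=
  Complex (limn (series (fun k => Re (x k * (y k)^*%C))))
          (limn (series (fun k => Im (x k * (y k)^*%C)))).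

Lemma ell2_ip_cvg (x y : ell2) :
  ccvg (fun n => \sum_(k < n) x k * (y k)^*%C) (ell2_ip x y).
Proof.
have bs : bounded_sums (fun k => cnorm2 (x k) + cnorm2 (y k)).
  have [C hC] := ell2_bounded x; have [D hD] := ell2_bounded y.
  by exists (C + D) => n; rewrite big_split lerD.
have ReS n : Re (\sum_(k < n) x k * (y k)^*%C) =
    series (fun k => Re (x k * (y k)^*%C)) n.
  by rewrite /series /= big_mkord cRe_sum.
have ImS n : Im (\sum_(k < n) x k * (y k)^*%C) =
    series (fun k => Im (x k * (y k)^*%C)) n.
  by rewrite /series /= big_mkord cIm_sum.
split => /=.
  under eq_fun do rewrite ReS; apply: dominated_series_cvg bs => k.
  rewrite cReM cReJ cImJ /cnorm2 ler_norml; case: (x k) => p q; case: (y k) => r s /=.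
  have := sqr_ge0 (p + r); have := sqr_ge0 (p - r).
  by have := sqr_ge0 (q + s); have := sqr_ge0 (q - s) => *; apply/andP; split; nra.
under eq_fun do rewrite ImS; apply: dominated_series_cvg bs => k.
rewrite cImM cReJ cImJ /cnorm2 ler_norml; case: (x k) => p q; case: (y k) => r s /=.
have := sqr_ge0 (p + s); have := sqr_ge0 (p - s).
by have := sqr_ge0 (q + r); have := sqr_ge0 (q - r) => *; apply/andP; split; nra.
Qed.

Lemma ell2_ip_lin (a : R[i]) (x y z : ell2) :
  ell2_ip (a *: x + y) z = a * ell2_ip x z + ell2_ip y z.
Proof.
apply: (ccvg_unique (ell2_ip_cvg _ _)).
have := ccvgD (ccvgZ a (ell2_ip_cvg x z)) (ell2_ip_cvg y z).
congr ccvg; apply/funext => n; rewrite mulr_sumr -big_split /=.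
by apply: eq_bigr => k _; rewrite -[RHS]/((a * x k + y k) * (z k)^*%C) mulrDl mulrA.
Qed.

Lemma ell2_ipC (x y : ell2) : ell2_ip y x = ((ell2_ip x y)^*)%C.
Proof.
apply: (ccvg_unique (ell2_ip_cvg _ _)); have := ccvgJ (ell2_ip_cvg x y).
congr ccvg; apply/funext => n; rewrite rmorph_sum; apply: eq_bigr => k _.
by rewrite rmorphM /= conjcK mulrC.
Qed.

Lemma ell2_ipxx_cvg (x : ell2) :
  series (fun k => cnorm2 (x k)) @ \oo --> Re (ell2_ip x x) /\ Im (ell2_ip x x) = 0.
Proof.
have E n : \sum_(k < n) x k * (x k)^*%C = ((series (fun k => cnorm2 (x k)) n)%:C)%C.
  rewrite /series /= big_mkord rmorph_sum; apply: eq_bigr => k _; exact: mulcJ.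
have [h1 h2] := ell2_ip_cvg x x; split.
  by move: h1; under eq_fun do rewrite E.
by rewrite -(cvg_lim _ h2) //; under eq_fun do rewrite E; rewrite lim_cst.
Qed.

Lemma ell2_sum_le_ip (x : ell2) n : \sum_(k < n) cnorm2 (x k) <= Re (ell2_ip x x).
Proof.
have [h _] := ell2_ipxx_cvg x.
apply: (ler_cvg_to (cvg_cst _) h); exists n => // m /= nm.
rewrite /series /= big_mkord.
apply: (sum_ord_mono (u := fun k => cnorm2 (x k)) _ nm) => k; exact: cnorm2_ge0.
Qed.

Lemma ell2_ip_le (x : ell2) (C : R) : (forall n, \sum_(k < n) cnorm2 (x k) <= C) ->
  Re (ell2_ip x x) <= C.
Proof.
move=> hC; have [h _] := ell2_ipxx_cvg x.
apply: (ler_cvg_to h (cvg_cst _)); apply: nearW => n.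
by rewrite /series /= big_mkord.
Qed.

Lemma ell2_ip_axioms : inner_product_axioms ell2_ip.
Proof.
split; [exact: ell2_ip_lin|exact: ell2_ipC| |].
  move=> x; have [_ i0] := ell2_ipxx_cvg x; rewrite lecE i0 eqxx.
  by have := ell2_sum_le_ip x 0; rewrite big_ord0.
move=> x x0; apply: ell2_ext => k; apply: cnorm2_eq0; apply/eqP.
rewrite eq_le cnorm2_ge0 andbT; have := ell2_sum_le_ip x k.+1.
rewrite x0 /= big_ord_recr /=; apply: le_trans; rewrite lerDr.
by apply: sumr_ge0 => j _; exact: cnorm2_ge0.
Qed.

Lemma cauchy_real_cvg (u : nat -> R) :
  (forall e, 0 < e -> exists N, forall m n, (N <= m)%N -> (N <= n)%N -> `|u m - u n| < e) ->
  exists l : R, u @ \oo --> l.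
Proof.
move=> h; suff /cvg_ex [l hl] : cvgn u by exists l.
apply/cauchy_cvgP/cauchy_exP => e e0; have [N hN] := h e e0.
exists (u N); exists N => // n /= Nn; rewrite -ball_normE /=; exact: hN.
Qed.

Lemma ell2_complete : hcomplete ell2_ip.
Proof.
move=> v hv.
have coord m n k : cnorm2 (v m k - v n k) <= norm2 ell2_ip (v m - v n).
  rewrite -ell2_subE; apply: le_trans (ell2_sum_le_ip (v m - v n) k.+1).
  by rewrite big_ord_recr /= lerDr sumr_ge0 // => j _; exact: cnorm2_ge0.
have hv2 e : 0 < e -> exists N, forall m n, (N <= m)%N -> (N <= n)%N ->
    norm2 ell2_ip (v m - v n) < e.
  move=> e0; have [N hN] := hv (Num.sqrt e) (etrans (sqrtr_gt0 e) e0).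
  exists N => m n Nm Nn; have := hN m n Nm Nn.
  by rewrite (hnorm_lt ell2_ip_axioms) ?sqrtr_gt0 // sqr_sqrtr // ltW.
have ex k : exists l, ccvg (fun n => v n k) l.
  have cau e : 0 < e -> exists N, forall m n, (N <= m)%N -> (N <= n)%N ->
      Num.sqrt (cnorm2 (v m k - v n k)) < e.
    move=> e0; have [N hN] := hv2 (e ^+ 2) (exprn_gt0 _ e0).
    exists N => m n Nm Nn; rewrite -(ger0_norm (ltW e0)) -sqrtr_sqr.
    by rewrite ltr_sqrt ?exprn_gt0 // (le_lt_trans (coord m n k)) // hN.
  have [|l1 h1] := @cauchy_real_cvg (fun n => Re (v n k)).
    move=> e /cau [N hN]; exists N => m n Nm Nn; apply: le_lt_trans (hN m n Nm Nn).
    have -> : Re (v m k) - Re (v n k) = Re (v m k - v n k).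
      by case: (v m k) => ? ?; case: (v n k).
    exact: Re_le_cnorm2.
  have [|l2 h2] := @cauchy_real_cvg (fun n => Im (v n k)).
    move=> e /cau [N hN]; exists N => m n Nm Nn; apply: le_lt_trans (hN m n Nm Nn).
    have -> : Im (v m k) - Im (v n k) = Im (v m k - v n k).
      by case: (v m k) => ? ?; case: (v n k).
    exact: Im_le_cnorm2.
  by exists (Complex l1 l2).
have [l hl] := choice ex.
have tail e N : (forall m n, (N <= m)%N -> (N <= n)%N -> norm2 ell2_ip (v m - v n) < e) ->
    forall n, (N <= n)%N -> forall M, \sum_(k < M) cnorm2 (v n k - l k) <= e.
  move=> hN n Nn M.
  have L := cvg_big_sum (r := index_enum 'I_M) (fun k : 'I_M =>
    cnorm2_cvg (ccvgD (ccvg_cst (v n k)) (ccvgZ (-1) (hl k)))).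
  under eq_bigr do rewrite -mulN1r.
  apply: (ler_cvg_to L (cvg_cst _)); exists N => // m /= Nm.
  apply: le_trans (ltW (hN n m Nn Nm)); under eq_bigr do rewrite mulN1r.
  exact: (ell2_sum_le_ip (v n - v m)).
have [N1 hN1] := hv2 1 ltr01.
have dl : (v N1 : nat -> R[i]) - l \in square_summable.
  by apply/square_summableP; exists 1 => n; exact: tail hN1 _ (leqnn _) _.
have ls : l \in square_summable.
  rewrite -[l](subKr (v N1 : nat -> R[i])); apply: rpredB => //.
  by case: (v N1).
exists (Ell2 ls); apply/(hcvgP ell2_ip_axioms)/cvg_natP => e e0.
have [|N hN] := hv2 (e / 2); first by rewrite divr_gt0.
exists N => n Nn; rewrite subr0 ger0_norm ?(norm2_ge0 ell2_ip_axioms) //.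
apply: (@le_lt_trans _ _ (e / 2)); last by rewrite ltr_pdivrMr // ltr_pMr // ltr1n.
by apply: ell2_ip_le => M; exact: tail hN n Nn M.
Qed.

Definition rat_complex (q : rat * rat) : R[i] := Complex (ratr q.1) (ratr q.2).

Lemma rat_complex_dense (z : R[i]) (d : R) : 0 < d ->
  exists q, cnorm2 (z - rat_complex q) < d.
Proof.
move=> d0; pose h := Num.sqrt (d / 2).
have h0 : 0 < h by rewrite sqrtr_gt0 divr_gt0.
have h2 : h ^+ 2 = d / 2 by rewrite sqr_sqrtr // ltW // divr_gt0.
case: z => x y.
have [|q1] := @rat_in_itvoo R (x - h) (x + h); first by lra.
have [|q2] := @rat_in_itvoo R (y - h) (y + h); first by lra.
rewrite !in_itv /= => /andP[a1 a2] /andP[b1 b2]; exists (q1, q2).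
rewrite /cnorm2 /= (splitr d) -h2.
by apply: ltrD; nra.
Qed.

Lemma finite_support_square_summable (s : seq (rat * rat)) :
  (fun k => rat_complex (nth (0, 0) s k)) \in square_summable.
Proof.
apply/square_summableP.
pose g k := cnorm2 (rat_complex (nth (0, 0) s k)).
exists (\sum_(k < size s) g k) => n.
apply: le_trans (sum_ord_mono (u := g) (fun k => cnorm2_ge0 _) (leq_maxl n (size s))) _.
rewrite -(big_mkord xpredT g) (big_cat_nat (n := size s)) ?leq_maxr //= big_mkord.
rewrite gerDl big_nat_cond big1 // => k; rewrite andbT => /andP[sk _].
by rewrite /g nth_default // /rat_complex !rmorph0 cnorm2_0.
Qed.

Lemma ell2_separable : hseparable ell2_ip.
Proof.
exists (fun n => Ell2 (finite_support_square_summable (odflt [::] (unpickle n)))).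
move=> x e e0.
have [C hC] := ell2_bounded x.
have [s [xs _ les]] := bounded_sums_cvg (fun k => cnorm2_ge0 (x k)) hC.
have e2 : 0 < e ^+ 2 / 4 by rewrite divr_gt0 // exprn_gt0.
have [K hK] := (cvg_natP _ _).1 xs _ e2.
have [q hq] := choice (fun k => rat_complex_dense (x k) (divr_gt0 e2 (ltr0Sn R K))).
exists (pickle [seq q k | k <- iota 0 K]); rewrite pickleK /=.
rewrite (hnorm_lt ell2_ip_axioms) //.
apply: (@le_lt_trans _ _ (e ^+ 2 / 2)); last first.
  by rewrite ltr_pdivrMr // ltr_pMr ?ltr1n // exprn_gt0.
apply: ell2_ip_le => n.
pose g k := cnorm2 (x k - rat_complex (nth (0, 0) [seq q k | k <- iota 0 K] k)).
rewrite (eq_bigr (fun k : 'I_n => g k)) //.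
apply: le_trans (sum_ord_mono (u := g) (fun k => cnorm2_ge0 _) (leq_maxl n K)) _.
rewrite -(big_mkord xpredT g) (big_cat_nat (n := K)) ?leq_maxr //= big_mkord.
have -> : e ^+ 2 / 2 = e ^+ 2 / 4 + e ^+ 2 / 4 by field.
apply: lerD.
  apply: le_trans (_ : \sum_(k < K) e ^+ 2 / 4 / K.+1%:R <= _).
    apply: ler_sum => k _; rewrite /g (nth_map 0%N) ?size_iota // nth_iota // add0n.
    exact/ltW/hq.
  rewrite sumr_const card_ord -[leLHS]mulr_natl mulrCA ler_piMr ?(ltW e2) //.
  by rewrite ler_pdivrMr ?ltr0Sn // mul1r ler_nat.
have gE k : (K <= k)%N -> g k = cnorm2 (x k).
  move=> Kk; rewrite /g nth_default ?size_map ?size_iota //.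
  by rewrite /rat_complex !rmorph0 subr0.
rewrite big_nat_cond (eq_bigr (fun k => cnorm2 (x k))); last first.
  by move=> k; rewrite andbT => /andP[Kk _]; exact: gE.
rewrite -big_nat_cond.
have := hK K (leqnn _); rewrite /series /= ltr_norml => /andP[h1 _].
have := les (maxn n K); rewrite -(big_mkord xpredT (fun k => cnorm2 (x k))).
rewrite (big_cat_nat (n := K)) ?leq_maxr //=; move: h1.
by set A := \sum_(0 <= _ < _) _; set B := \sum_(_ <= _ < _) _; lra.
Qed.

Lemma delta_square_summable j : (fun k => (j == k)%:R) \in square_summable.
Proof.
apply/square_summableP; exists 1 => n.
have [jn|nj] := ltnP j n.
  rewrite (bigD1 (Ordinal jn)) //= eqxx big1 ?addr0.
    by rewrite /cnorm2 /= expr1n expr0n addr0.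
  by move=> k kj; rewrite eq_sym (negbTE (kj : (k : nat) != j)) cnorm2_0.
rewrite big1 // => k _; rewrite gtn_eqF ?cnorm2_0 //.
exact: leq_trans (ltn_ord k) nj.
Qed.

Definition ell2_delta j : ell2 := Ell2 (delta_square_summable j).

Lemma ell2_ip_delta (x : ell2) k : ell2_ip x (ell2_delta k) = x k.
Proof.
apply: (ccvg_unique (ell2_ip_cvg _ _)).
have [E1 E2] : ccvg (fun=> x k) (x k) by exact: ccvg_cst.
have E n : (k < n)%N -> \sum_(j < n) x j * (ell2_delta k j)^*%C = x k.
  have dE j : (ell2_delta k j)^*%C = (k == j)%:R :> R[i] by rewrite -(rmorph_nat (@conjc R)).
  move=> kn; under eq_bigr do rewrite dE.
  rewrite (bigD1 (Ordinal kn)) //= eqxx mulr1 big1 ?addr0 // => j jk.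
  by rewrite eq_sym (negbTE (jk : (j : nat) != k)) mulr0.
split; [apply: cvg_trans E1 | apply: cvg_trans E2]; apply: near_eq_cvg;
  by exists k.+1 => // n /= kn; rewrite E.
Qed.

Lemma ell2_delta_onb : complete_orthonormal ell2_ip ell2_delta.
Proof.
split=> [j k|x x0]; first by rewrite ell2_ip_delta.
by apply: ell2_ext => k; rewrite -ell2_ip_delta x0.
Qed.

Lemma ell2_separable_hilbert : separable_hilbert ell2_ip.
Proof. by split; [exact: ell2_ip_axioms|exact: ell2_complete|exact: ell2_separable]. Qed.

End Ell2.

Lemma nneseries_of_cvg (R : realType) (u : nat -> R) (s : R) :
  series u @ \oo --> s -> (\sum_(k <oo) (u k)%:E)%E = s%:E.
Proof.
move=> us; rewrite -(cvg_lim _ us) // -EFin_lim; last by apply/cvg_ex; exists s.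
by congr (limn _); apply/funext => n; rewrite /= /series /= sumEFin.
Qed.

Lemma nneseries_eq_pinfty (R : realType) (u : nat -> R) : (forall k, 0 <= u k) ->
  (\sum_(k <oo) (u k)%:E)%E = +oo%E <-> ~ bounded_sums u.
Proof.
move=> u0; split=> [h [C hC]|nb].
  have [s [us _ _]] := bounded_sums_cvg u0 hC.
  by have := nneseries_of_cvg us; rewrite h.
have ge n : ((\sum_(k < n) u k)%:E <= \sum_(k <oo) (u k)%:E)%E.
  rewrite -sumEFin -(big_mkord xpredT (fun k => (u k)%:E)).
  by apply: nneseries_lim_ge => k _ _; rewrite lee_fin.
case: (\sum_(k <oo) _)%E ge => [r||] ge //.
  by exfalso; apply: nb; exists r => n; rewrite -lee_fin.
by have := ge 0%N; rewrite leeNy_eq.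
Qed.

(** * The inverse problem *)

Section Model.
Variables (R : realType) (a b : nat -> R).
Hypothesis ab : forall k, b k < a k.
Hypothesis ba : forall k, a k.+1 < b k.
Hypothesis a_gt0 : forall k, 0 < a k.
Hypothesis a_small : forall e : R, 0 < e -> exists N, a N < e.
Local Notation m := (mass a b).
Let c k : R[i] := ((Num.sqrt (a k * m k))%:C)%C.

Lemma model_coef_norm k : cnorm2 (c k) = a k * m k.
Proof. by rewrite cnorm2R sqr_sqrtr // mulr_ge0 ?ltW ?mass_gt0. Qed.

Lemma model_coef_neq0 k : c k != 0.
Proof.
by apply/eqP => h; have /eqP := model_coef_norm k; rewrite h cnorm2_0 eq_sym gt_eqF
  // mulr_gt0 ?mass_gt0.
Qed.

Lemma model_coef_bounded : bounded_sums (fun k => cnorm2 (c k)).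
Proof.
exists (a 0%N) => n; apply: (@le_trans _ _ (\sum_(k < n) a 0%N * m k)).
  apply: ler_sum => k _; rewrite model_coef_norm ler_wpM2r ?(a_anti ab ba) //.
  by rewrite ltW // mass_gt0.
by rewrite -mulr_sumr ler_piMr ?(ltW (a_gt0 0)) // sum_mass_le.
Qed.

Lemma a_injective : injective a.
Proof.
move=> i j aij; apply/eqP; apply: contraT => ij.
by have := a_neq ab ba ij; rewrite aij eqxx.
Qed.

Lemma diag_borg_triple (lam mu : nat -> R) (H : lmodType R[i]) (ip : H -> H -> R[i])
    (u : nat -> H) (W W1 : H -> H) (p : H) :
  (forall k, lam k ^+ 2 = a k) -> (forall k, mu k ^+ 2 = b k) ->
  inner_product_axioms ip -> hcomplete ip -> complete_orthonormal ip u ->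
  (forall x k, ip (W x) (u k) = ((a k)%:C)%C * ip x (u k)) ->
  (forall x, W1 x = W x - rank_one ip p x) ->
  (forall k, ip p (u k) = c k) ->
  borg_triple ip lam mu W W1 p.
Proof.
move=> la mb ipP cplt [uP ut] Wd W1E pu.
have aa i j : (i <= j)%N -> a j <= a i by exact: a_anti.
split => //.
- split.
  + exact: diag_selfadjoint Wd.
  + exact: diag_nonneg Wd a_gt0.
  + exact: diag_ker Wd a_gt0.
  + exact: diag_compact Wd a_gt0 a_small aa.
  + split=> [z|k].
      have [h1 h2] := diag_eigenvalue ipP uP ut Wd z.
      split=> [/h1 [k ->]|[k zk]]; first by exists k; rewrite la.
      by apply: h2; exists k; rewrite zk la.
    by rewrite la; exact: (diag_simple ipP uP ut Wd a_injective k).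
- exact: rank_one_compact Wd a_gt0 _ _ W1E a_small aa.
- move=> z; have := @rank_one_spectrum R H ip ipP u uP cplt ut a W Wd a_gt0
    a_injective p W1 W1E b ab ba a_small.
  have E k : cnorm2 (ip p (u k)) = a k * m k by rewrite pu model_coef_norm.
  have E2 k : cnorm2 (ip p (u k)) / a k = m k by rewrite E mulrC mulKf // gt_eqF.
  move=> h; have [|n|j|h1 h2] := h _ _ _ z.
  + by move=> k; rewrite E gt_eqF // mulr_gt0 // mass_gt0.
  + by under eq_bigr do rewrite E2; exact: sum_mass_le.
  + by under eq_fun do rewrite E2; exact: mass_secular.
  + split=> [/h1 [k ->]|[k zk]]; first by exists k; rewrite mb.
    by apply: h2; exists k; rewrite zk mb.
Qed.

Lemma borg_triple_unique (lam mu : nat -> R) (H H' : lmodType R[i])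
    (ip : H -> H -> R[i]) (ip' : H' -> H' -> R[i])
    (u : nat -> H) (W W1 : H -> H) (p : H) (W' W1' : H' -> H') (p' : H') :
  (forall k, lam k ^+ 2 = a k) -> (forall k, mu k ^+ 2 = b k) ->
  inner_product_axioms ip -> hcomplete ip -> complete_orthonormal ip u ->
  (forall x k, ip (W x) (u k) = ((a k)%:C)%C * ip x (u k)) ->
  (forall x, W1 x = W x - rank_one ip p x) ->
  (forall k, ip p (u k) = c k) ->
  separable_hilbert ip' -> borg_triple ip' lam mu W' W1' p' ->
  unitarily_equivalent ip ip' W W1 p W' W1' p'.
Proof.
move=> la mb ipP cplt uP Wd W1E pu [ipP' cplt' _].
move=> [[Wsa Wge0 Wker Wcpt [Weig Wsimple]] W1E' _ W1eig].
have [u' [uP' Wu']] : exists u' : nat -> H',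
    complete_orthonormal ip' u' /\ forall k, W' (u' k) = ((a k)%:C)%C *: u' k.
  apply: eigenbasis_exists => //; first exact: a_injective.
    move=> z; rewrite Weig; split=> -[k ->]; exists k; by rewrite la.
  by move=> k; rewrite -la.
have Wd1 x k : ip' (W' x) (u' k) = ((a k)%:C)%C * ip' x (u' k).
  by rewrite Wsa Wu' ipZr //= oppr0.
have [u1' u2'] := uP'.
have [s1 s2] : (forall n, \sum_(k < n) cnorm2 (ip' p' (u' k)) / a k <= 1) /\
    (forall j, series (fun k => cnorm2 (ip' p' (u' k)) / a k * (a k / (a k - b j)))
       @ \oo --> (1 : R)).
  apply: (rank_one_spectrum_secular ipP' u1' cplt' u2' Wd1 a_gt0 W1E' ab ba).
  by move=> z; rewrite W1eig; split=> -[k ->]; exists k; rewrite mb.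
have massE : m = fun k => cnorm2 (ip' p' (u' k)) / a k.
  apply: (secular_unique ab ba a_gt0 a_small) => //.
  - by move=> k; rewrite ltW // mass_gt0.
  - by move=> n; exact: sum_mass_le.
  - by move=> j; exact: mass_secular.
  - by move=> k; rewrite divr_ge0 ?cnorm2_ge0 // ltW.
have [|s [uP2 pu2]] := rephase ipP' (p := p') (c := c) uP' _ model_coef_neq0.
  by move=> k; rewrite model_coef_norm massE mulrC divfK // gt_eqF.
apply: (coordinate_equivalence ipP ipP' cplt cplt' uP uP2 Wd) => //.
  by move=> x k; rewrite (ipZr ipP') (ipZr ipP') Wd1 mulrCA.
by move=> k; rewrite pu pu2.
Qed.

Lemma eigenbasis_coef (H : lmodType R[i]) (ip : H -> H -> R[i])
    (u u2 : nat -> H) (W : H -> H) (p : H) :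
  inner_product_axioms ip -> complete_orthonormal ip u ->
  (forall x k, ip (W x) (u k) = ((a k)%:C)%C * ip x (u k)) ->
  (forall k, ip (u2 k) (u2 k) = 1) -> (forall k, W (u2 k) = ((a k)%:C)%C *: u2 k) ->
  forall k, cnorm2 (ip p (u2 k)) = cnorm2 (ip p (u k)).
Proof.
move=> ipP [uP ut] Wd u21 Wu2 k.
have E := diag_eigenvector ipP uP ut Wd a_injective (Wu2 k).
have := u21 k; rewrite E; set s := ip (u2 k) (u k).
rewrite ipZl // ipZr // uP eqxx mulr1 mulcJ => -[s1].
by rewrite ipZr // cnorm2M cnorm2J s1 mul1r.
Qed.

End Model.

Unset Implicit Arguments.

Theorem theorem4p1 (R : realType) (lam mu : nat -> R) :
  (forall k : nat, lam k != 0) ->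
  (forall k : nat, mu k != 0) ->
  (forall k : nat, `|lam k| > `|mu k|) ->
  (forall k : nat, `|mu k| > `|lam k.+1|) ->
  (fun k => lam k ^+ 2) @ \oo --> (0 : R^o) ->
  exists (H : lmodType R[i]) (ip : H -> H -> R[i]) (W W1 : H -> H) (p : H),
    [/\ separable_hilbert ip,
        borg_triple ip lam mu W W1 p,
        (forall (H' : lmodType R[i]) (ip' : H' -> H' -> R[i]) (W' W1' : H' -> H') (p' : H'),
            separable_hilbert ip' -> borg_triple ip' lam mu W' W1' p' ->
            unitarily_equivalent ip ip' W W1 p W' W1' p')
      & forall u : nat -> H, orthonormal_eigenbasis ip W lam u ->
          (norm_W_mhalf ip lam u p = 1%E <->
             (\sum_(j <oo) (1 - mu j ^+ 2 / lam j ^+ 2)%:E)%E = +oo%E) /\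
          ((\sum_(j <oo) (1 - mu j ^+ 2 / lam j ^+ 2)%:E)%E = +oo%E ->
             (norm_W_m1 ip lam u p = +oo%E <->
                (\sum_(j <oo) (mu j ^+ 2 / lam j.+1 ^+ 2 - 1)%:E)%E = +oo%E))].
Proof.
move=> lam0 mu0 lam_mu mu_lam lam_to0.
pose a k := lam k ^+ 2; pose b k := mu k ^+ 2.
have sq (x y : R) : `|x| < `|y| -> x ^+ 2 < y ^+ 2.
  move=> xy; rewrite -[x ^+ 2]real_normK ?num_real // -[y ^+ 2]real_normK ?num_real //.
  by rewrite ltr_pXn2r ?nnegrE.
have ab k : b k < a k by exact: sq.
have ba k : a k.+1 < b k by exact: sq.
have a_gt0 k : 0 < a k by rewrite lt_def sqrf_eq0 lam0 sqr_ge0.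
have a_small e : 0 < e -> exists N, a N < e.
  move=> e0; have [N hN] := (cvg_natP _ _).1 lam_to0 e e0; exists N.
  by have := hN N (leqnn N); rewrite subr0 ger0_norm ?sqr_ge0.
have [W Wd] : exists W : ell2 R -> ell2 R, forall x k,
    ell2_ip (W x) (ell2_delta R k) = ((a k)%:C)%C * ell2_ip x (ell2_delta R k).
  apply: (diag_op_exists (C := a 0%N) (@ell2_ip_axioms R) (@ell2_delta_onb R).1 (@ell2_complete R)).
  by move=> k; rewrite gtr0_norm ?(a_anti ab ba).
have [p [_ pu]] := riesz_fischer (@ell2_ip_axioms R) (@ell2_delta_onb R).1 (@ell2_complete R)
  (model_coef_bounded ab ba a_gt0).
exists (ell2 R), (@ell2_ip R), W, (fun x => W x - rank_one (@ell2_ip R) p x), p.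
split.
- exact: ell2_separable_hilbert.
- by apply: (diag_borg_triple ab ba a_gt0 a_small _ _ (@ell2_ip_axioms R) (@ell2_complete R)
    (@ell2_delta_onb R) Wd).
- move=> H' ip' W' W1' p'.
  exact: (borg_triple_unique ab ba a_gt0 a_small _ _ (@ell2_ip_axioms R) (@ell2_complete R)
    (@ell2_delta_onb R) Wd).
move=> u [u1 _ Wu].
have coef k : cnorm2 (ell2_ip p (u k)) = a k * mass a b k.
  rewrite (eigenbasis_coef ab ba p (@ell2_ip_axioms R) (@ell2_delta_onb R) Wd) //.
    by rewrite pu model_coef_norm.
  by move=> j; rewrite u1 eqxx.
have mass0 k : 0 <= mass a b k by rewrite ltW // mass_gt0.
have halfE k : cnorm2 (ell2_ip p (u k)) / lam k ^+ 2 = mass a b k.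
  by rewrite coef -/(a k) mulrC mulKf // gt_eqF.
have oneE k : cnorm2 (ell2_ip p (u k)) / lam k ^+ 4 = mass a b k / a k.
  have ak0 : a k != 0 by rewrite gt_eqF.
  have -> : lam k ^+ 4 = a k ^+ 2 by rewrite -exprM.
  by rewrite coef; field.
have [s [ms s1 _]] := bounded_sums_cvg mass0 (sum_mass_le ab ba).
have s0 : 0 <= s.
  by apply: (ler_cvg_to (cvg_cst _) ms); apply: nearW => n; exact: sumr_ge0.
have x0 j : 0 <= 1 - mu j ^+ 2 / lam j ^+ 2.
  by rewrite -/(b j) -/(a j) subr_ge0 ler_pdivrMr // mul1r ltW.
have y0 j : 0 <= mu j ^+ 2 / lam j.+1 ^+ 2 - 1.
  by rewrite -/(b j) -/(a j.+1) subr_ge0 ler_pdivlMr // mul1r ltW.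
have sum1 : series (mass a b) @ \oo --> (1 : R) <->
    (\sum_(j <oo) (1 - mu j ^+ 2 / lam j ^+ 2)%:E)%E = +oo%E.
  by rewrite nneseries_eq_pinfty // sum_mass_eq1.
split.
  rewrite -sum1 /norm_W_mhalf.
  under eq_eseriesr do rewrite halfE.
  rewrite (nneseries_of_cvg ms) /=; split=> [[sq1]|m1].
    by move: ms; rewrite -[s]sqr_sqrtr // sq1 expr1n.
  by rewrite -(cvg_lim _ ms) // (cvg_lim _ m1) // sqrtr1.
move=> /sum1 m1; rewrite nneseries_eq_pinfty // /norm_W_m1.
under eq_eseriesr do rewrite oneE.
have my0 k : 0 <= mass a b k / a k by rewrite divr_ge0 // ltW.
have bs := bounded_sums_mass_div ab ba a_gt0 a_small m1.
rewrite -[X in _ <-> ~ X]bs -nneseries_eq_pinfty //.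
by case: (\sum_(k <oo) _)%E.
Qed.
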